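(* Let $N\ge1$, $p=2N+1$, $\mathbb{T}=\mathbb{R}/(2\pi\mathbb{Z})$, and let $\mathcal{V}_{odd}$, $B_r$ and $\lambda_0(t,b,v)$ be as in the context. For $0\le t_0<t_1<\dots<t_N\le\pi$ and $b\in\mathbb{T}$ define $\Lambda:\mathcal{V}_{odd}\to\mathbb{R}^{N+1}$ by $\Lambda(v)=(\lambda_0(t_j,b,v))_{j=0}^N$. (i) Let $b\in\mathbb{T}$ be sufficiently small. Then for some $r>0$ the mapping $\Lambda:B_r\to\Lambda(B_r)$ is a real analytic bijection, where $\Lambda(B_r)\subset\mathbb{R}^{N+1}$ is an open domain and $0\in\Lambda(B_r)$. (ii) In the case of (i), for any $\varepsilon\in(0,r)$ there exist a potential $v\in B_\varepsilon$ and a potential $w\in\mathcal{V}_{odd}$, $w\notin B_\varepsilon$, such that $\Lambda(w)=\Lambda(v)$; i.e. $\Lambda$ is not globally injective. (iii) Let $b\in\mathbb{T}$ (arbitrary) and let $t_k\in[0,2\pi)$, $k\in\{1,\dots,p\}$, be a sequence of distinct numbers. Then for sufficiently small $r>0$ the vector $(\lambda_0(t_k,b,v))_{k=1}^p$ uniquely determines the potential $v\in B_r$.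
   Context: $\mathcal{V}_{odd}=\{v=(v_k)_1^p\in\mathbb{R}^p:\ v_{2k}=0,\ k=1,\dots,N\}$, equipped with the Euclidean norm $\|\cdot\|$ of $\mathbb{R}^p$, and $B_r=\{v\in\mathcal{V}_{odd}:\|v\|<r\}$ for $r>0$. For $t\in[0,2\pi]$, $b\in\mathbb{T}$, $v\in\mathbb{R}^p$, $J_t(b,v)$ is the symmetric $p\times p$ Jacobi matrix with diagonal $v_1,\dots,v_p$ and off-diagonal entries $(J_t)_{n,n+1}=(J_t)_{n+1,n}=a_n$, $1\le n\le p-1$, where $a_n=1$ for $n$ even and $a_n=2|\cos(\frac t2-\frac{3n-2}{2}b)|$ for $n$ odd. Its eigenvalues are ordered as $\lambda_{-N}(t,b,v)\le\dots\le\lambda_0(t,b,v)\le\dots\le\lambda_N(t,b,v)$. ''$b\in\mathbb{T}$ sufficiently small'' means that $b$ lies in some neighbourhood of $0\in\mathbb{T}$ (which may depend on $N$ and $t_0,\dots,t_N$). *)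

(* Defs.v *)
From HB Require Import structures.
From mathcomp Require Import all_boot all_order all_algebra.
From mathcomp Require Import spectral complex.
From mathcomp Require Import all_classical all_reals all_analysis.
From mathcomp Require Import ring zify.

Set Implicit Arguments.
Unset Strict Implicit.
Unset Printing Implicit Defensive.

Import Order.TTheory GRing.Theory Num.Theory.
Import numFieldNormedType.Exports.

Local Open Scope classical_set_scope.
Local Open Scope ring_scope.

(* The eigenvalues of A in nondecreasing order, repeated according to their
   algebraic multiplicity; meaningful when char_poly A splits over R, hence
   for every symmetric A (ordered_eigenvaluesP below). *)
Definition is_ordered_spectrum (R : realType) (n : nat) (A : 'M[R]_n)
    (s : seq R) : Prop :=
  sorted <=%R s /\ char_poly A = \prod_(x <- s) ('X - x%:P).

Definition ordered_eigenvalues (R : realType) (n : nat) (A : 'M[R]_n) : seq R :=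
  xget [::] [set s | is_ordered_spectrum A s].

Lemma is_ordered_spectrum_inj (R : realType) (n : nat) (A : 'M[R]_n) s1 s2 :
  is_ordered_spectrum A s1 -> is_ordered_spectrum A s2 -> s1 = s2.
Proof.
move=> [S1 E1] [S2 E2].
apply: (sorted_eq le_trans le_anti S1 S2).
by apply/allP => x _ /=; rewrite -!mu_prod_XsubC -E1 -E2.
Qed.

Lemma ordered_eigenvaluesP (R : realType) (n : nat) (A : 'M[R]_n) :
  A^T = A -> is_ordered_spectrum A (ordered_eigenvalues A).
Proof.
move=> symA.
suff [s hs] : exists s, char_poly A = \prod_(x <- s) ('X - x%:P).
  apply: (@xgetPex _ [::] [set s | is_ordered_spectrum A s]).
  exists (sort <=%R s); split; first exact: (sort_sorted le_total).
  by rewrite hs; apply: perm_big; rewrite perm_sym perm_sort.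
pose f : {rmorphism R -> R[i]} := real_complex R.
pose B : 'M[R[i]]_n := map_mx f A.
have hB : B \is hermsymmx.
  apply/is_hermitianmxP; rewrite expr0 scale1r -map_trmx /B -[in RHS]symA.
  apply/matrixP => i j; rewrite !mxE.
  by apply/esym/CrealP; apply/Creal_ImP; rewrite -complexIm /=.
have /mxOverP Dr := hermitian_spectral_diag_real hB.
have /hermitian_normalmx /orthomx_spectralP := hB.
have := spectral_unit B.
move: (spectralmx B) (spectral_diag B) Dr => P d Dr Pu eB.
exists [seq complex.Re (d 0 i) | i <- enum 'I_n].
apply: (map_poly_inj f); rewrite map_char_poly -/B.
have -> : char_poly B = char_poly (diag_mx d).
  rewrite eB /char_poly /char_poly_mx.
  pose Q := map_mx (@polyC _) P.
  have Qu : Q \in unitmx by rewrite map_unitmx.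
  have -> : 'X%:M - map_mx polyC (invmx P *m diag_mx d *m P) =
      invmx Q *m ('X%:M - map_mx polyC (diag_mx d)) *m Q.
    rewrite mulmxBr mulmxBl !map_mxM map_invmx; congr (_ - _).
    by rewrite scalar_mxC -mulmxA mulVmx// mulmx1.
  by rewrite !det_mulmx mulrAC -det_mulmx mulVmx// det1 mul1r.
rewrite char_poly_trig ?diag_mx_is_trig//.
rewrite rmorph_prod big_map big_enum /=; apply: eq_bigr => i _.
rewrite mxE eqxx mulr1n rmorphB /= map_polyX map_polyC /=; congr (_ - _%:P).
exact/esym/RRe_real/Dr.
Qed.

(* The off-diagonal entry a_n, with n >= 1. *)
Definition offdiag (R : realType) (t b : R) (n : nat) : R :=
  if odd n then 2 * `|cos (t / 2 - (3 * n%:R - 2) / 2 * b)| else 1.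

(* Rows and columns are numbered from 0, so that the (n, n+1) entry of the
   matrix, in the usual numbering from 1, sits at (n.-1, n). *)
Definition jacobi (R : realType) (N : nat) (t b : R) (v : 'rV[R]_(N.*2.+1)) :
    'M[R]_(N.*2.+1) :=
  \matrix_(i, j)
    if i == j then v 0 i
    else if j == i.+1 :> nat then offdiag t b j
    else if i == j.+1 :> nat then offdiag t b i
    else 0.

Lemma jacobi_sym (R : realType) (N : nat) (t b : R) (v : 'rV[R]_(N.*2.+1)) :
  (jacobi t b v)^T = jacobi t b v.
Proof.
apply/matrixP => i j; rewrite !mxE [j == i]eq_sym.
case: (i =P j) => [->//|_].
case: eqP => [->|//]; case: eqP => // /eqP.
by rewrite -[X in X == _]addn0 -addn2 eqn_add2l.
Qed.

Lemma norm_cosDpi (R : realType) (x : R) (k : int) :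
  `|cos (x + pi * k%:~R)| = `|cos x|.
Proof.
have H n (y : R) : `|cos (y + pi * n%:R)| = `|cos y|.
  elim: n y => [|n IH] y; first by rewrite mulr0 addr0.
  by rewrite -natr1 mulrDr mulr1 addrA cosDpi normrN IH.
case: k => n; first exact: H.
by rewrite -(H n.+1 (x + _)) NegzE mulrNz mulrN subrK.
Qed.

Lemma jacobi_periodic (R : realType) (N : nat) (t b : R) (k : int)
    (v : 'rV[R]_(N.*2.+1)) :
  jacobi t (b + 2 * pi * k%:~R) v = jacobi t b v.
Proof.
have H n : offdiag t (b + 2 * pi * k%:~R) n = offdiag t b n.
  rewrite /offdiag; case: ifP => // _; congr (_ * _).
  rewrite -[RHS](norm_cosDpi _ (- ((3 * n%:Z - 2) * k))); congr (`|cos _|).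
  by field.
by apply/matrixP => i j; rewrite !mxE !H.
Qed.

(* With lambda_(-N) at index 0 of the list, lambda_0 is at index N. *)
Definition lambda0 (R : realType) (N : nat) (t b : R) (v : 'rV[R]_(N.*2.+1)) : R :=
  nth 0 (ordered_eigenvalues (jacobi t b v)) N.

Definition Lambda (R : realType) (N n : nat) (t : 'I_n -> R) (b : R)
    (v : 'rV[R]_(N.*2.+1)) : 'rV[R]_n :=
  \row_j lambda0 (t j) b v.

(* The entries with even number in the numbering from 1 have an odd index. *)
Definition Vodd (R : realType) (N : nat) : set 'rV[R]_(N.*2.+1) :=
  [set v | forall i : 'I_(N.*2.+1), odd i -> v 0 i = 0].

(* The norm `|v| of the library on row vectors is the sup norm. *)
Definition enorm (R : realType) (n : nat) (v : 'rV[R]_n) : R :=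
  Num.sqrt (\sum_i v 0 i ^+ 2).

Definition Bodd (R : realType) (N : nat) (r : R) : set 'rV[R]_(N.*2.+1) :=
  [set v | Vodd v /\ enorm v < r].

(* The linear isomorphism R^(N+1) -> Vodd, u |-> (u_0, 0, u_1, 0, ..., 0, u_N). *)
Definition Vodd_of (R : realType) (N : nat) (u : 'rV[R]_N.+1) :
    'rV[R]_(N.*2.+1) :=
  \row_i if odd i then 0 else u 0 (inord i./2).

Lemma Vodd_of_bij (R : realType) (N : nat) :
  set_bij setT (@Vodd R N) (@Vodd_of R N).
Proof.
split.
- by move=> u _ i hi; rewrite mxE hi.
- move=> u w _ _ /rowP e; apply/rowP => j.
  have hj : (j.*2 < N.*2.+1)%N by rewrite ltnS leq_double -ltnS.
  by have := e (Ordinal hj); rewrite !mxE /= odd_double doubleK inord_val.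
- move=> v hv; exists (\row_(j < N.+1) v 0 (inord j.*2)) => //.
  apply/rowP => i; rewrite !mxE; case: ifPn => [/hv->//|hi].
  rewrite inordK; last by have := ltn_ord i; lia.
  by rewrite even_halfK// inord_val.
Qed.

Definition monomial (R : realType) (n : nat) (h : 'rV[R]_n)
    (k : {ffun 'I_n -> nat}) : R :=
  \prod_i h 0 i ^+ k i.

(* On a cube around x, f is the sum of an absolutely convergent power series;
   by absolute convergence its sum is the limit of the partial sums over the
   multi-indices in the boxes {0, ..., m-1}^n. *)
Definition real_analytic_at (R : realType) (n : nat) (f : 'rV[R]_n -> R)
    (x : 'rV[R]_n) : Prop :=
  exists (c : {ffun 'I_n -> nat} -> R) (rho : R), 0 < rho /\
    forall h : 'rV[R]_n, (forall i, `|h 0 i| < rho) ->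
      summable setT (fun k => (c k * monomial h k)%:E) /\
      (\sum_(k : {ffun 'I_n -> 'I_m})
         c [ffun i => k i : nat] * monomial h [ffun i => k i : nat])
        @[m --> \oo] --> f (x + h).

Definition real_analytic_on (R : realType) (n m : nat) (U : set 'rV[R]_n)
    (F : 'rV[R]_n -> 'rV[R]_m) : Prop :=
  forall x, U x -> forall j, real_analytic_at (fun y => F y 0 j) x.

(* Analyticity on a subset of the vector space Vodd, read in its linear
   coordinates (v_1, v_3, ..., v_p). *)
Definition real_analytic_Vodd (R : realType) (N m : nat)
    (U : set 'rV[R]_(N.*2.+1)) (F : 'rV[R]_(N.*2.+1) -> 'rV[R]_m) : Prop :=
  real_analytic_on (@Vodd_of R N @^-1` U) (F \o @Vodd_of R N).

(* A domain is an open connected set. *)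
Definition analytic_bij_onto_domain (R : realType) (N m : nat)
    (U : set 'rV[R]_(N.*2.+1)) (F : 'rV[R]_(N.*2.+1) -> 'rV[R]_m) : Prop :=
  [/\ real_analytic_Vodd U F, set_bij U (F @` U) F,
      open (F @` U), connected (F @` U) & (F @` U) 0].

(* A point of T = R/(2 pi Z) is given by a real representative b, on which
   jacobi depends only modulo 2 pi (jacobi_periodic); near_T0 delta is the
   delta-neighbourhood of 0 in T. *)
Definition near_T0 (R : realType) (delta b : R) : Prop :=
  exists k : int, `|b - 2 * pi * k%:~R| < delta.

(* Main.v *)
(** Restricted to the sites v_1, v_3, ..., v_p the matrix J_t(b, v) is diagonal,
    because it couples only neighbouring sites.  By the min-max principle
    |lambda_0(v)| <= max |v_i|; in particular lambda_0(0) = 0, with eigenvector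
    psi_1 = 1, psi_{2k+1} = - a_{2k-1} psi_{2k-1}, psi_{2k} = 0.  The two-term
    recursions for eigenvectors show that every eigenvector of J_t(b, v) with a
    small eigenvalue is close to a multiple of psi when v is small.  If phi and
    chi are the eigenvectors of lambda_0(v) and lambda_0(w), then
      (lambda_0(v) - lambda_0(w)) <phi, chi> = \sum_i (v_i - w_i) phi_i chi_i,
    so that lambda_0 is strictly differentiable at 0 with gradient
    psi_i^2 / |psi|^2.  Here psi_{2k+1}^2 = \prod_{m <= k} (2 + 2 cos (t - (6m-5) b)).

    For b = 0 the Jacobian of Lambda is, up to row scaling, a Vandermonde matrix
    in 2 + 2 cos t_j, hence it is invertible for small b.  In (iii) a vector in
    the kernel gives a trigonometric polynomial of degree at most N with 2N+1
    zeros.  Local injectivity and openness of the image follow by contraction.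
    Analyticity: lambda_0 is a continuous simple root of a polynomial whose
    coefficients are polynomials in v, and the Picard iterates of the Newton map
    converge in the l^1 norm of power series.

    For (ii), the potential k (e_p - e_1) with k large has N eigenvalues of size
    O(1/k), and lambda_0 is one of them. *)
Require Import Defs.
From HB Require Import structures.
From mathcomp Require Import all_boot all_order all_algebra.
From mathcomp Require Import complex.
From mathcomp Require Import all_classical all_reals all_analysis.
From mathcomp Require Import ring lra zify.
Import Order.TTheory GRing.Theory Num.Theory.
Import numFieldNormedType.Exports.
Local Open Scope classical_set_scope.
Local Open Scope ring_scope.

Set Implicit Arguments.
Unset Strict Implicit.
Unset Printing Implicit Defensive.

(** * Spectral theorem and min-max principle for real symmetric matrices *)

Section RealSpectral.
Variable R : realType.

Definition sqn (n : nat) (x : 'rV[R]_n) : R := \sum_i x 0 i ^+ 2.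

Lemma mul_row_tr n (x y : 'rV[R]_n) :
  x *m y^T = (\sum_i x 0 i * y 0 i)%:M.
Proof.
by rewrite [LHS]mx11_scalar mxE; congr (_%:M); apply: eq_bigr => i _; rewrite mxE.
Qed.

Lemma sqnE n (x : 'rV[R]_n) : x *m x^T = (sqn x)%:M.
Proof. by rewrite mul_row_tr; congr (_%:M); apply: eq_bigr => i _; rewrite expr2. Qed.

Lemma sqn_ge0 n (x : 'rV[R]_n) : 0 <= sqn x.
Proof. by apply: sumr_ge0 => i _; apply: sqr_ge0. Qed.

Lemma sqn_eq0 n (x : 'rV[R]_n) : (sqn x == 0) = (x == 0).
Proof.
apply/eqP/eqP => [/eqP|->]; last by apply: big1 => i _; rewrite mxE expr0n.
rewrite psumr_eq0 => [/allP h|i _]; last exact: sqr_ge0.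
apply/rowP => i; rewrite mxE; apply/eqP; rewrite -sqrf_eq0.
exact: h (mem_index_enum _).
Qed.

Lemma sqnZ n a (x : 'rV[R]_n) : sqn (a *: x) = a ^+ 2 * sqn x.
Proof. by rewrite /sqn mulr_sumr; apply: eq_bigr => i _; rewrite mxE exprMn. Qed.

Lemma orthogonal_completion n (u : 'rV[R]_n.+1) :
  sqn u = 1 -> exists2 H : 'M[R]_n.+1, H *m H^T = 1%:M & row 0 H = u.
Proof.
move=> u1; pose e := delta_mx 0 0 : 'rV[R]_n.+1.
have e1 : sqn e = 1.
  rewrite /sqn (bigD1 0) //= big1 ?addr0 => [|i hi]; rewrite !mxE eqxx ?(negbTE hi) //=.
    by rewrite expr1n.
  by rewrite expr0n.
have [->|ne] := eqVneq u e.
  exists 1%:M; first by rewrite trmx1 mulmx1.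
  by rewrite rowE mulmx1.
(* Householder reflection exchanging [e] and [u] *)
pose w := u - e; pose q := sqn w.
have q0 : q != 0 by rewrite sqn_eq0 subr_eq0.
pose c := 2 / q; pose H := 1%:M - c *: (w^T *m w).
have HT : H^T = H by rewrite /H linearB /= trmx1 linearZ /= trmx_mul trmxK.
have WW : (w^T *m w) *m (w^T *m w) = q *: (w^T *m w).
  by rewrite mulmxA -[w^T *m w *m w^T]mulmxA sqnE -/q mul_mx_scalar -scalemxAl.
have HH : H *m H^T = 1%:M.
  rewrite HT /H; move: (w^T *m w) WW => W WW.
  rewrite mulmxBl mul1mx mulmxBr mulmx1 -scalemxAl -scalemxAr WW !scalerA.
  rewrite (_ : c * c * q = c + c); last by rewrite /c; field.
  by rewrite scalerDl opprB addrK subrK.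
exists H => //; rewrite rowE -/e /H mulmxBr mulmx1 -scalemxAr mulmxA.
(* Both vectors being unit, q = 2 (1 - <e, u>), whereas <e, w> = <e, u> - 1. *)
have ew : e *m w^T = (- (q / 2))%:M.
  have uu := sqnE u; have ee := sqnE e; rewrite u1 in uu; rewrite e1 in ee.
  have eu : u *m e^T = e *m u^T.
    rewrite !mul_row_tr; congr (_%:M); apply: eq_bigr => i _; exact: mulrC.
  have ww : (q%:M : 'M[R]_1) = 2 *: (1%:M - e *m u^T).
    rewrite -sqnE /w linearB /= mulmxBr !mulmxBl uu ee eu.
    by rewrite scaler_nat mulr2n opprB addrA addrAC -!addrA addrCA.
  rewrite /w linearB /= mulmxBr ee -[LHS]opprB.
  rewrite (_ : 1%:M - _ = (q / 2)%:M); first by rewrite -raddfN.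
  apply: (@scalerI _ _ (2 : R)); first by rewrite pnatr_eq0.
  by rewrite -ww scale_scalar_mx; congr (_%:M); field.
rewrite ew mul_scalar_mx scalerA (_ : c * _ = -1); last by rewrite /c; field.
by rewrite scaleN1r opprK /w addrC subrK.
Qed.

(** Deflation by induction on n. [ordered_eigenvaluesP] supplies a real eigenvalue; a unit
    eigenvector is completed to an orthogonal [H], and by symmetry the conjugate of [A] by [H]
    splits into a 1 x 1 block and a smaller symmetric block. *)
Lemma real_spectral n (A : 'M[R]_n) : A^T = A ->
  exists (Q : 'M[R]_n) (d : 'rV[R]_n),
    Q *m Q^T = 1%:M /\ A = Q^T *m diag_mx d *m Q.
Proof.
elim: n A => [|n IH] A symA.
  by exists 1%:M, 0; split; apply/matrixP => - [].
have [_ cpA] := ordered_eigenvaluesP symA.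
move: cpA; case: (ordered_eigenvalues A) => [|a s] cpA.
  by have := size_char_poly A; rewrite cpA big_nil size_poly1.
have /eigenvalueP [u uA u0] : eigenvalue A a.
  by rewrite eigenvalue_root_char cpA root_prod_XsubC inE eqxx.
pose u1 := (Num.sqrt (sqn u))^-1 *: u.
have s0 : 0 < sqn u by rewrite lt_def sqn_eq0 u0 sqn_ge0.
have u1n : sqn u1 = 1.
  rewrite /u1 sqnZ exprVn sqr_sqrtr ?sqn_ge0 // mulVf //.
  by rewrite gt_eqF.
have u1A : u1 *m A = a *: u1 by rewrite /u1 -scalemxAl uA !scalerA mulrC.
have [H HH rH] := orthogonal_completion u1n.
have HH' := mulmx1C HH.
have [B [symB rB AE]] : exists B : 'M[R]_n.+1,
    [/\ B^T = B, row 0 B = a *: delta_mx 0 0 & A = H^T *m B *m H].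
  exists (H *m A *m H^T); split.
  - by rewrite !trmx_mul trmxK symA mulmxA.
  - by rewrite !row_mul rH u1A -scalemxAl -rH -row_mul HH rowE mulmx1.
  - by rewrite !mulmxA HH' mul1mx -mulmxA HH' mulmx1.
have B0j j : B 0 j = a *+ (j == 0).
  by move/rowP: rB => /(_ j); rewrite !mxE eqxx /= mulr_natr.
have Bj0 j : B j 0 = a *+ (j == 0) by rewrite -[B]symB mxE B0j.
pose B' := drsubmx (B : 'M[R]_(1 + n)).
have BE : (B : 'M[R]_(1 + n)) = block_mx a%:M 0 0 B'.
  rewrite -[LHS](@submxK R 1 n 1 n); congr block_mx; apply/matrixP => i j; rewrite ?ord1.
  - by rewrite !mxE lshift0 B0j eqxx.
  - by rewrite !mxE lshift0 B0j.
  - by rewrite !mxE lshift0 Bj0.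
have symB' : B'^T = B' by rewrite /B' trmx_drsub symB.
have [Q' [d' [QQ' B'E]]] := IH _ symB'.
pose Q1 : 'M[R]_(1 + n) := block_mx 1%:M 0 0 Q'.
pose D1 : 'rV[R]_(1 + n) := row_mx a%:M d'.
have Q1T : Q1^T = block_mx 1%:M 0 0 Q'^T.
  by rewrite /Q1 (@tr_block_mx R 1 n 1 n) !trmx0 trmx1.
have Q1Q1 : Q1 *m Q1^T = 1%:M.
  rewrite Q1T /Q1 (@mulmx_block R 1 n 1 n 1 n) QQ'.
  by rewrite ?(mulmx0, mul0mx, mulmx1, addr0, add0r) -scalar_mx_block.
have Q1B : B = Q1^T *m @diag_mx R (1 + n) D1 *m Q1.
  rewrite Q1T /Q1 /D1 (@diag_mx_row R n 1) !(@mulmx_block R 1 n 1 n 1 n).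
  rewrite ?(mulmx0, mul0mx, mul1mx, mulmx1, addr0, add0r) -B'E BE.
  congr (@block_mx R 1 n 1 n _ _ _ _).
  by apply/matrixP => i j; rewrite !ord1 !mxE eqxx.
exists (Q1 *m H), D1; split.
  by rewrite trmx_mul mulmxA -[_ *m H *m _]mulmxA HH mulmx1 Q1Q1.
by rewrite AE trmx_mul Q1B !mulmxA.
Qed.

Lemma char_poly_spectral n (A Q : 'M[R]_n) (d : 'rV[R]_n) :
  Q *m Q^T = 1%:M -> A = Q^T *m diag_mx d *m Q ->
  char_poly A = \prod_i ('X - (d 0 i)%:P).
Proof.
move=> QQ AE.
have -> : char_poly A = char_poly (diag_mx d).
  rewrite /char_poly /char_poly_mx AE.
  pose P := map_mx (@polyC _) Q.
  have PP : P *m P^T = 1%:M by rewrite /P map_trmx -map_mxM QQ map_mx1.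
  have -> : 'X%:M - map_mx polyC (Q^T *m diag_mx d *m Q) =
      P^T *m ('X%:M - map_mx polyC (diag_mx d)) *m P.
    rewrite mulmxBr mulmxBl !map_mxM -map_trmx; congr (_ - _).
    by rewrite scalar_mxC -mulmxA (mulmx1C PP) mulmx1.
  by rewrite !det_mulmx mulrAC -det_mulmx (mulmx1C PP) det1 mul1r.
rewrite char_poly_trig ?diag_mx_is_trig //.
by apply: eq_bigr => i _; rewrite mxE eqxx mulr1n.
Qed.

Lemma capmx_nz n k l (U : 'M[R]_(k, n)) (V : 'M[R]_(l, n)) :
  (n < \rank U + \rank V)%N -> exists2 x : 'rV[R]_n, x != 0 & (x <= U)%MS && (x <= V)%MS.
Proof.
move=> h; have hc : (U :&: V)%MS != 0.
  rewrite -mxrank_eq0 -lt0n -(ltn_add2l (\rank (U + V)%MS)) addn0 mxrank_sum_cap.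
  exact: leq_ltn_trans (rank_leq_col _) h.
exists (nz_row (U :&: V)%MS); first by rewrite nz_row_eq0.
by rewrite -sub_capmx nz_row_sub.
Qed.

Definition qform n (A : 'M[R]_n) (x : 'rV[R]_n) : R :=
  \sum_j (x *m A) 0 j * x 0 j.

Lemma qformE n (A : 'M[R]_n) x : x *m A *m x^T = (qform A x)%:M.
Proof. exact: mul_row_tr. Qed.

Lemma qformN n (A : 'M[R]_n) x : qform (- A) x = - qform A x.
Proof. by rewrite /qform -sumrN; apply: eq_bigr => j _; rewrite mulmxN mxE mulNr. Qed.

(** On the span of the eigenvectors with eigenvalue above c the form exceeds c |x|^2 for x nonzero.
    That span therefore meets [U] only in 0, and the dimensions add up to at most n. *)
Lemma count_spectrum n k (A Q : 'M[R]_n) d (U : 'M[R]_(k, n)) c :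
  Q *m Q^T = 1%:M -> A = Q^T *m diag_mx d *m Q ->
  (forall x, (x <= U)%MS -> qform A x <= c * sqn x) ->
  (#|[set i | (c < d 0 i)%R]%SET| + \rank U <= n)%N.
Proof.
move=> QQ AE hU; set I := [set i | _]%SET; rewrite leqNgt; apply/negP => hlt.
pose f : 'I_#|I| -> 'I_n := enum_val.
pose W := rowsub f Q.
have WQ : W *m Q^T = rowsub f 1%:M by rewrite /W mul_rowsub_mx QQ.
have Wr : \rank W = #|I|.
  apply/eqP; rewrite -/(row_free W); apply/row_freeP.
  exists (Q^T *m (rowsub f 1%:M)^T); rewrite mulmxA WQ.
  apply/matrixP => i j; rewrite !mxE (bigD1 (f i)) //= big1 ?addr0.
    by rewrite !mxE eqxx mul1r (inj_eq enum_val_inj) eq_sym.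
  by move=> l hl; rewrite !mxE eq_sym (negbTE hl) mul0r.
have [x x0 /andP[xW xU]] : exists2 x : 'rV[R]_n, x != 0 & (x <= W)%MS && (x <= U)%MS.
  by apply: capmx_nz; rewrite Wr.
pose y := x *m Q^T.
have xE : x = y *m Q by rewrite /y -mulmxA (mulmx1C QQ) mulmx1.
have y0 i : i \notin I -> y 0 i = 0.
  move=> hi; case/submxP: xW => z xz.
  rewrite /y xz -mulmxA WQ mxE big1 // => j _; rewrite !mxE.
  case: eqP => [fj|]; last by rewrite mulr0.
  by move: hi; rewrite -fj enum_valP.
have sx : sqn x = sqn y.
  have /(congr1 (fun M : 'M[R]_1 => M 0 0)) : (sqn x)%:M = (sqn y)%:M :> 'M[R]_1.
    by rewrite -!sqnE {1 2}xE trmx_mul !mulmxA -[_ *m Q *m _]mulmxA QQ mulmx1.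
  by rewrite !mxE.
have qx : qform A x = \sum_i d 0 i * y 0 i ^+ 2.
  have /(congr1 (fun M : 'M[R]_1 => M 0 0)) :
      (qform A x)%:M = (\sum_i d 0 i * y 0 i ^+ 2)%:M :> 'M[R]_1.
    rewrite -qformE AE !mulmxA -/y.
    have -> : y *m diag_mx d *m Q *m x^T = y *m diag_mx d *m y^T.
      by rewrite /y trmx_mul trmxK !mulmxA.
    rewrite mul_row_tr; congr (_%:M); apply: eq_bigr => i _.
    by rewrite mul_mx_diag mxE; ring.
  by rewrite !mxE.
have := hU _ xU; rewrite qx sx mulr_sumr leNgt => /negP; apply.
(* The difference is the sum of (d_i - c) y_i^2. Its terms are nonnegative since y vanishes off [I],
   and if they all vanished, then so would y and x. *)
rewrite -subr_gt0 -sumrB lt_def; apply/andP; split; last first.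
  apply: sumr_ge0 => i _; rewrite -mulrBl.
  case: (boolP (i \in I)) => [|/y0 ->]; last by rewrite expr0n mulr0.
  by rewrite inE => h; rewrite mulr_ge0 ?sqr_ge0 // subr_ge0 ltW.
apply: contraNneq x0 => /eqP; rewrite psumr_eq0; last first.
  move=> i _; rewrite -mulrBl.
  case: (boolP (i \in I)) => [|/y0 ->]; last by rewrite expr0n mulr0.
  by rewrite inE => h; rewrite mulr_ge0 ?sqr_ge0 // subr_ge0 ltW.
move=> /allP h; rewrite xE (_ : y = 0) ?mul0mx //; apply/rowP => i; rewrite [RHS]mxE.
case: (boolP (i \in I)) => [|/y0 //]; rewrite inE => hi.
have /implyP/(_ isT) := h i (mem_index_enum _).
by rewrite -mulrBl mulf_eq0 sqrf_eq0 subr_eq0 gt_eqF //= => /eqP.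
Qed.

Lemma ordered_eigenvalues_perm n (A Q : 'M[R]_n) d :
  A^T = A -> Q *m Q^T = 1%:M -> A = Q^T *m diag_mx d *m Q ->
  perm_eq (ordered_eigenvalues A) [seq d 0 i | i <- enum 'I_n].
Proof.
move=> symA QQ AE; have [_ cp] := ordered_eigenvaluesP symA.
apply/allP => x _ /=; rewrite -!mu_prod_XsubC -cp (char_poly_spectral QQ AE).
by rewrite big_map big_enum.
Qed.

Lemma count_map_enum n (d : 'I_n -> R) (a : pred R) :
  count a [seq d i | i <- enum 'I_n] = #|[set i | a (d i)]%SET|.
Proof.
by rewrite count_map enumT cardsE cardE /enum_mem size_filter.
Qed.

Lemma size_ordered_eigenvalues n (A : 'M[R]_n) :
  A^T = A -> size (ordered_eigenvalues A) = n.
Proof.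
move=> symA; have [Q [d [QQ AE]]] := real_spectral symA.
by rewrite (perm_size (ordered_eigenvalues_perm symA QQ AE)) size_map size_enum_ord.
Qed.

(** If entry m of the sorted spectrum exceeded c, so would the n - m entries from m on, too many for
    [count_spectrum]. *)
Lemma minmax_le n k (A : 'M[R]_n) (U : 'M[R]_(k, n)) c m :
  A^T = A -> (forall x, (x <= U)%MS -> qform A x <= c * sqn x) ->
  (m < \rank U)%N -> nth 0 (ordered_eigenvalues A) m <= c.
Proof.
move=> symA hU hm; have [Q [d [QQ AE]]] := real_spectral symA.
have := count_spectrum QQ AE hU; rewrite -(count_map_enum (fun i => d 0 i) (fun x => c < x)).
have pe := ordered_eigenvalues_perm symA QQ AE.
move/permP: (pe) => <-; rewrite leNgt => hc; apply/negP => lt.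
have [ss _] := ordered_eigenvaluesP symA.
have sz := size_ordered_eigenvalues symA.
have hmn : (m < n)%N := leq_trans hm (rank_leq_col U).
move: hc; set s := ordered_eigenvalues A in ss sz lt *.
set K := count _ _; suff : (n - m <= K)%N by lia.
rewrite /K.
rewrite -(cat_take_drop m s) count_cat -sz -size_drop.
apply: leq_trans (leq_addl _ _); apply/eq_leq/esym/eqP; rewrite -all_count.
apply/(all_nthP 0) => i hi; rewrite nth_drop; apply: lt_le_trans lt _.
apply: (sorted_leq_nth le_trans le_refl 0 ss) => //; rewrite ?inE ?leq_addr // ?sz //.
by move: hi; rewrite size_drop sz; lia.
Qed.

(** [count_spectrum] for - A: at most n - rank U, hence at most m, eigenvalues lie below c, but an
    entry m below c would yield m + 1 of them. *)
Lemma minmax_ge n k (A : 'M[R]_n) (U : 'M[R]_(k, n)) c m :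
  A^T = A -> (forall x, (x <= U)%MS -> c * sqn x <= qform A x) ->
  (n <= m + \rank U)%N -> (m < n)%N -> c <= nth 0 (ordered_eigenvalues A) m.
Proof.
move=> symA hU hm hmn; have [Q [d [QQ AE]]] := real_spectral symA.
have AE' : - A = Q^T *m diag_mx (- d) *m Q.
  rewrite AE (_ : diag_mx (- d) = - diag_mx d) ?mulmxN ?mulNmx //.
  by apply/matrixP => i j; rewrite !mxE mulNrn.
have hU' x : (x <= U)%MS -> qform (- A) x <= - c * sqn x.
  by move=> /hU; rewrite qformN mulNr lerN2.
have := count_spectrum QQ AE' hU'.
rewrite -(count_map_enum (fun i => (- d) 0 i) (fun x => - c < x)).
have pe := ordered_eigenvalues_perm symA QQ AE.
rewrite count_map (@eq_count _ _ (preim (fun i => d 0 i) (fun x => x < c))); last first.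
  by move=> i /=; rewrite mxE ltrN2.
rewrite -count_map; move/permP: (pe) => <-; rewrite leNgt => hc; apply/negP => lt.
have [ss _] := ordered_eigenvaluesP symA.
have sz := size_ordered_eigenvalues symA.
move: hc; set s := ordered_eigenvalues A in ss sz lt *.
set K := count _ _; suff : (m.+1 <= K)%N by lia.
rewrite /K.
rewrite -(cat_take_drop m.+1 s) count_cat.
have st : size (take m.+1 s) = m.+1 by rewrite size_take sz; case: ltnP => //; lia.
rewrite -{1}st; apply: leq_trans (leq_addr _ _).
apply/eq_leq/esym/eqP; rewrite -all_count; apply/(all_nthP 0) => i hi.
rewrite nth_take; last by rewrite -st.
apply: le_lt_trans lt; apply: (sorted_leq_nth le_trans le_refl 0 ss); rewrite ?inE ?sz //.
- by move: hi; rewrite st; lia.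
- by move: hi; rewrite st; lia.
Qed.

(** Simplicity takes the form in which Newton's map uses it, a nonzero derivative of the
    characteristic polynomial. *)
Lemma simple_eigenvalue n (A Q : 'M[R]_n) d i :
  Q *m Q^T = 1%:M -> A = Q^T *m diag_mx d *m Q ->
  (forall j, j != i -> d 0 j != d 0 i) -> (char_poly A)^`().[d 0 i] != 0.
Proof.
move=> QQ AE hd; rewrite (char_poly_spectral QQ AE) (bigD1 i) //=.
rewrite derivM derivXsubC mul1r hornerD hornerM hornerXsubC subrr mul0r addr0.
rewrite horner_prod; apply/prodf_neq0 => j hj.
by rewrite hornerXsubC subr_eq0 eq_sym hd.
Qed.

Lemma spectral_eigenvector n (A Q : 'M[R]_n) d i :
  Q *m Q^T = 1%:M -> A = Q^T *m diag_mx d *m Q ->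
  row i Q *m A = d 0 i *: row i Q.
Proof.
move=> QQ AE; rewrite AE !mulmxA -row_mul QQ rowE mulmx1.
have -> : (delta_mx 0 i : 'rV_n) *m diag_mx d = d 0 i *: delta_mx 0 i.
  apply/rowP => j; rewrite mul_mx_diag !mxE eqxx /=; case: eqP => [->|_].
    by rewrite mul1r mulr1.
  by rewrite mul0r mulr0.
by rewrite -scalemxAl -rowE.
Qed.

End RealSpectral.

(** * Analyticity of simple roots *)

Section PolynomialFunctions.
Variables (R : realType) (n : nat).
Local Notation mindex := {ffun 'I_n -> nat}.
Local Notation mpol := (seq (R * mindex)).
Implicit Types (p q : mpol) (k l : mindex) (h : 'rV[R]_n).

(* A polynomial is a list of terms in which a monomial may occur several
   times: no terms are collected, so that [pnorm] is multiplicative. *)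
Definition peval p h : R := \sum_(x <- p) x.1 * monomial h x.2.

(** A weighted l^1 norm of the coefficients; it dominates |[peval p h]| on the cube of half-side
    [rho]. *)
Definition pnorm (rho : R) p : R :=
  \sum_(x <- p) `|x.1| * monomial (const_mx rho : 'rV[R]_n) x.2.

Definition pmul p q : mpol :=
  [seq (x.1 * y.1, [ffun i => (x.2 i + y.2 i)%N]) | x : R * mindex <- p, y : R * mindex <- q].

Definition pconst (a : R) : mpol := [:: (a, [ffun=> 0%N])].

Definition ppow p m : mpol := iter m (pmul p) (pconst 1).

Fixpoint psum (F : nat -> mpol) m : mpol :=
  if m is m'.+1 then psum F m' ++ F m' else [::].

Lemma monomial0 h : monomial h [ffun=> 0%N] = 1.
Proof. by rewrite /monomial big1 // => i _; rewrite ffunE expr0. Qed.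

Lemma monomialD h k l :
  monomial h [ffun i => (k i + l i)%N] = monomial h k * monomial h l.
Proof.
by rewrite /monomial -big_split; apply: eq_bigr => i _; rewrite ffunE exprD.
Qed.

Lemma monomial_const (rho : R) k :
  monomial (const_mx rho : 'rV[R]_n) k = rho ^+ (\sum_i k i)%N.
Proof. by rewrite /monomial -prodrXr; apply: eq_bigr => i _; rewrite mxE. Qed.

Lemma monomial_le rho h k : (forall i, `|h 0 i| <= rho) ->
  `|monomial h k| <= monomial (const_mx rho : 'rV[R]_n) k.
Proof.
move=> hh; rewrite /monomial normr_prod; apply: ler_prod => i _.
by rewrite normr_ge0 mxE normrX lerXn2r // ?nnegrE ?(le_trans _ (hh i)).
Qed.

Lemma peval_cat p q h : peval (p ++ q) h = peval p h + peval q h.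
Proof. exact: big_cat. Qed.

Lemma pnorm_cat rho p q : pnorm rho (p ++ q) = pnorm rho p + pnorm rho q.
Proof. exact: big_cat. Qed.

Lemma peval_mul p q h : peval (pmul p q) h = peval p h * peval q h.
Proof.
rewrite /peval /pmul big_allpairs_dep big_distrlr.
by apply: eq_bigr => x _; apply: eq_bigr => y _; rewrite /= monomialD mulrACA.
Qed.

Lemma pnorm_mul rho p q : pnorm rho (pmul p q) = pnorm rho p * pnorm rho q.
Proof.
rewrite /pnorm /pmul big_allpairs_dep big_distrlr.
by apply: eq_bigr => x _; apply: eq_bigr => y _; rewrite /= monomialD normrM mulrACA.
Qed.

Lemma peval_const a h : peval (pconst a) h = a.
Proof. by rewrite /peval big_seq1 /= monomial0 mulr1. Qed.

Lemma pnorm_const rho a : pnorm rho (pconst a) = `|a|.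
Proof. by rewrite /pnorm big_seq1 /= monomial0 mulr1. Qed.

Lemma peval_pow p m h : peval (ppow p m) h = peval p h ^+ m.
Proof.
by elim: m => [|m IH] /=; rewrite ?peval_const // peval_mul IH exprS.
Qed.

Lemma pnorm_pow rho p m : pnorm rho (ppow p m) = pnorm rho p ^+ m.
Proof.
by elim: m => [|m IH] /=; rewrite ?pnorm_const ?normr1 // pnorm_mul IH exprS.
Qed.

Lemma peval_sum F m h : peval (psum F m) h = \sum_(i < m) peval (F i) h.
Proof.
elim: m => [|m IH] /=; first by rewrite /peval big_nil big_ord0.
by rewrite peval_cat IH big_ord_recr.
Qed.

Lemma pnorm_sum rho F m : pnorm rho (psum F m) = \sum_(i < m) pnorm rho (F i).
Proof.
elim: m => [|m IH] /=; first by rewrite /pnorm big_nil big_ord0.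
by rewrite pnorm_cat IH big_ord_recr.
Qed.

Lemma monomial_const_ge0 rho k : 0 <= rho ->
  0 <= monomial (const_mx rho : 'rV[R]_n) k.
Proof. by move=> r0; rewrite monomial_const exprn_ge0. Qed.

Lemma pnorm_ge0 rho p : 0 <= rho -> 0 <= pnorm rho p.
Proof.
by move=> r0; apply: sumr_ge0 => x _; rewrite mulr_ge0 ?monomial_const_ge0.
Qed.

Lemma pnorm_le1 rho p : 0 <= rho <= 1 -> pnorm rho p <= pnorm 1 p.
Proof.
move=> /andP[r0 r1]; apply: ler_sum => x _; rewrite ler_wpM2l //.
by rewrite !monomial_const expr1n exprn_ile1.
Qed.

(** Every monomial has degree at least 1, so one factor [rho] can be taken out. *)
Lemma pnorm_small rho p : 0 <= rho <= 1 -> all (fun x => x.2 != [ffun=> 0%N]) p ->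
  pnorm rho p <= rho * pnorm 1 p.
Proof.
move=> /andP[r0 r1] /allP hp; rewrite /pnorm mulr_sumr big_seq [leRHS]big_seq.
apply: ler_sum => x xp; rewrite mulrCA ler_wpM2l //.
rewrite !monomial_const expr1n mulr1.
have [m ->] : exists m, (\sum_i x.2 i = m.+1)%N.
  case E : (\sum_i x.2 i)%N => [|m]; last by exists m.
  case/eqP: (hp _ xp); apply/ffunP => i; rewrite ffunE.
  by apply/eqP; move/eqP: E; rewrite sum_nat_eq0 => /forallP /(_ i).
by rewrite exprS ler_piMr // exprn_ile1.
Qed.

(** The value at 0 is the sum of the constant terms. They may be present and cancel, which [pnorm]
    does not see; removing them makes [pnorm_small] applicable. *)
Lemma drop_constant_term p : peval p 0 = 0 ->
  exists2 q, all (fun x => x.2 != [ffun=> 0%N]) q & forall h, peval q h = peval p h.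
Proof.
move=> p0; exists [seq x <- p | x.2 != [ffun=> 0%N]]; first exact: filter_all.
have E h : peval p h =
    peval [seq x <- p | x.2 != [ffun=> 0%N]] h + \sum_(x <- p | x.2 == [ffun=> 0%N]) x.1.
  rewrite /peval (bigID (fun x => x.2 != [ffun=> 0%N])) /= big_filter; congr (_ + _).
  under eq_bigl do rewrite negbK.
  by apply: eq_bigr => x /eqP ->; rewrite monomial0 mulr1.
suff s0 : \sum_(x <- p | x.2 == [ffun=> 0%N]) x.1 = 0 by move=> h; rewrite E s0 addr0.
have := E 0; rewrite p0 /peval big_filter big1 ?add0r // => x hx.
rewrite (_ : monomial _ _ = 0) ?mulr0 //; apply/eqP; rewrite prodf_seq_eq0 /=.
have [i hi] : exists i, x.2 i != 0%N.
  apply: contrapT => hn; case/eqP: hx; apply/ffunP => i; rewrite ffunE.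
  by apply/eqP/negP => /negP hi; apply: hn; exists i.
apply/hasP; exists i; first exact: mem_index_enum.
by rewrite mxE expr0n (negbTE hi) eqxx.
Qed.

(** * Power series as limits of polynomials *)

Definition pcoef k p : R := \sum_(x <- p | x.2 == k) x.1.

Lemma pcoef_cat k p q : pcoef k (p ++ q) = pcoef k p + pcoef k q.
Proof. exact: big_cat. Qed.

Lemma sum_pcoef (X : seq mindex) p h : uniq X -> all (fun x => x.2 \in X) p ->
  \sum_(k <- X) pcoef k p * monomial h k = peval p h.
Proof.
move=> uX /allP hp; rewrite /peval big_seq.
under eq_bigr do rewrite /pcoef big_mkcond mulr_suml.
rewrite -big_seq exchange_big /= [RHS]big_seq [LHS]big_seq; apply: eq_bigr => x xp.
rewrite (bigD1_seq x.2) //=; last exact: hp.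
by rewrite eqxx big1 ?addr0 // => k hk; rewrite eq_sym (negbTE hk) mul0r.
Qed.

(** By the triangle inequality, collecting the terms of a list can only decrease the l^1 norm. *)
Lemma sum_norm_pcoef rho (X : seq mindex) p h : 0 <= rho ->
  uniq X -> (forall i, `|h 0 i| <= rho) ->
  \sum_(k <- X) `|pcoef k p| * `|monomial h k| <= pnorm rho p.
Proof.
move=> r0 uX hh.
apply: (@le_trans _ _ (\sum_(k <- X) \sum_(x <- p)
  (if x.2 == k then `|x.1| * monomial (const_mx rho : 'rV[R]_n) k else 0))).
  apply: ler_sum => k _; rewrite -big_mkcond -mulr_suml.
  by apply: ler_pM => //; [exact: ler_norm_sum|exact: monomial_le].
rewrite exchange_big /=; apply: ler_sum => x _.
have [xX|xX] := boolP (x.2 \in X).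
  rewrite (bigD1_seq x.2) //= eqxx big1 ?addr0 // => k hk.
  by rewrite eq_sym (negbTE hk).
rewrite big_seq big1 ?mulr_ge0 ?monomial_const_ge0 // => k hk.
by case: eqP => // e; rewrite e hk in xX.
Qed.

Lemma cvg_sumr (I : Type) (r : seq I) (u : I -> nat -> R) (l : I -> R) :
  (forall i, u i m @[m --> \oo] --> l i) ->
  (\sum_(i <- r) u i m) @[m --> \oo] --> \sum_(i <- r) l i.
Proof.
move=> hu; elim: r => [|i r IH].
  rewrite (_ : (fun m => _) = cst 0); first by rewrite big_nil; exact: cvg_cst.
  by apply/funext => m; rewrite big_nil.
rewrite (_ : (fun m => _) = fun m => u i m + \sum_(i <- r) u i m).
  by rewrite big_cons; exact: cvgD.
by apply/funext => m; rewrite big_cons.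
Qed.

Lemma summable_bounded (c : mindex -> R) (B : R) :
  (forall X : seq mindex, uniq X -> \sum_(k <- X) `|c k| <= B) ->
  summable setT (fun k => (c k)%:E).
Proof.
move=> hB; rewrite /summable /esum.
apply: (@le_lt_trans _ _ B%:E); last by rewrite ltry.
apply: ge_ereal_sup => _ [A [fA _] <-].
rewrite fsbig_finite //= sumEFin lee_fin; apply: hB; exact: finmap.fset_uniq.
Qed.

Definition box (m : nat) : seq mindex :=
  [seq [ffun i => (k i : nat)] | k : {ffun 'I_n -> 'I_m} <- enum {ffun 'I_n -> 'I_m}].

Lemma box_uniq m : uniq (box m).
Proof.
rewrite map_inj_uniq ?enum_uniq // => k l /ffunP e; apply/ffunP => i.
by apply: val_inj; have := e i; rewrite !ffunE.
Qed.

Lemma mem_box m k : (forall i, (k i < m)%N) -> k \in box m.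
Proof.
move=> hk; apply/mapP; exists [ffun i => Ordinal (hk i)]; first by rewrite mem_enum.
by apply/ffunP => i; rewrite !ffunE.
Qed.

(** The increments [D m] decay geometrically in [pnorm], so each coefficient of their partial sums
    converges, and the limits are the coefficients of the power series. *)
Lemma analytic_of_polys (f : 'rV[R]_n -> R) x (rho B : R) (D : nat -> mpol) :
  0 < rho -> (forall m, pnorm rho (D m) <= B * 2^-1 ^+ m) ->
  (forall h, (forall i, `|h 0 i| < rho) ->
     peval (psum D m) h @[m --> \oo] --> f (x + h)) ->
  real_analytic_at f x.
Proof.
move=> rho0 hD hf.
have B0 : 0 <= B by have := le_trans (pnorm_ge0 _ (ltW rho0)) (hD 0%N); rewrite expr0 mulr1.
pose c k := limn (series (fun m => pcoef k (D m))).
have serE k m : series (fun m => pcoef k (D m)) m = pcoef k (psum D m).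
  rewrite /series /= big_mkord; elim: m => [|m IH].
    by rewrite big_ord0 /pcoef big_nil.
  by rewrite big_ord_recr /= IH pcoef_cat.
have cvgc k : pcoef k (psum D m) @[m --> \oo] --> c k.
  under eq_cvg do rewrite -serE.
  suff cv : cvgn (series (fun m => pcoef k (D m))) by exact: cv.
  apply: normed_cvg.
  pose w := monomial (const_mx rho : 'rV[R]_n) k.
  have w0 : 0 < w by rewrite /w monomial_const exprn_gt0.
  apply: (@series_le_cvg _ _ (geometric (B / w) 2^-1)).
  - by move=> m /=.
  - by move=> m /=; rewrite mulr_ge0 ?exprn_ge0 ?invr_ge0 ?divr_ge0 // ltW.
  - move=> m /=; rewrite mulrAC ler_pdivlMr //; apply: le_trans (hD m).
    have := @sum_norm_pcoef rho [:: k] (D m) (const_mx rho) (ltW rho0) isT.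
    rewrite big_seq1 -/w (gtr0_norm w0); apply=> i; by rewrite mxE gtr0_norm.
  - by apply: is_cvg_geometric_series; rewrite gtr0_norm ?invr_gt0 // invf_lt1 // ltr1n.
have tail j m : (j <= m)%N ->
    pnorm rho (drop (size (psum D j)) (psum D m)) <= 2 * B * 2^-1 ^+ j /\
    psum D m = psum D j ++ drop (size (psum D j)) (psum D m).
  move=> jm.
  suff [q qE qn] : exists2 q, psum D m = psum D j ++ q &
      pnorm rho q <= 2 * B * 2^-1 ^+ j - 2 * B * 2^-1 ^+ m.
    rewrite qE drop_size_cat //; split=> //; apply: le_trans qn _.
    by rewrite gerBl !mulr_ge0 ?exprn_ge0 ?invr_ge0.
  elim: m jm => [|m IH]; rewrite leq_eqVlt => /orP[/eqP <-|].
  - by exists [::]; rewrite ?cats0 // /pnorm big_nil subrr.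
  - by [].
  - by exists [::]; rewrite ?cats0 // /pnorm big_nil subrr.
  rewrite ltnS => /IH [q qE qn]; exists (q ++ D m); first by rewrite /= qE catA.
  rewrite pnorm_cat; apply: le_trans (lerD qn (hD m)) _.
  by rewrite exprS le_eqVlt; apply/orP; left; apply/eqP; field.
(* The bound [tail] passes to the limit over any finite set of multi-indices. The case j = 0 gives
   absolute convergence, large j the value of the sum. *)
have key j (X : seq mindex) h : uniq X -> (forall i, `|h 0 i| < rho) ->
    \sum_(k <- X) `|c k - pcoef k (psum D j)| * `|monomial h k| <= 2 * B * 2^-1 ^+ j.
  move=> uX hh.
  have cv : (\sum_(k <- X) `|pcoef k (psum D m) - pcoef k (psum D j)| * `|monomial h k|)
      @[m --> \oo] --> \sum_(k <- X) `|c k - pcoef k (psum D j)| * `|monomial h k|.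
    apply: cvg_sumr => k; apply: cvgMl; apply: cvg_norm; apply: cvgB => //.
    exact: cvg_cst.
  apply: (cvgr_to_le cv); near=> m.
  have [|tn tE] := tail j m; first by near: m; exact: nbhs_infty_ge.
  apply: le_trans tn; rewrite {1}tE.
  under eq_bigr do rewrite pcoef_cat addrAC subrr add0r.
  by apply: sum_norm_pcoef => // [|i]; exact: ltW.
exists c, rho; split=> // h hh; split.
  apply: (@summable_bounded _ (2 * B)) => X uX.
  have := key 0%N X h uX hh; rewrite expr0 mulr1; apply: le_trans.
  by apply: ler_sum => k _; rewrite normrM /= /pcoef big_nil subr0.
have boxE m : \sum_(k : {ffun 'I_n -> 'I_m})
    c [ffun i => k i : nat] * monomial h [ffun i => k i : nat] =
    \sum_(k <- box m) c k * monomial h k by rewrite big_map big_enum.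
under eq_cvg do rewrite boxE.
apply/cvgrPdist_le => e e0.
have e3 : 0 < e / 2 by rewrite divr_gt0.
have [j [hj1 hj2]] : exists j, 2 * B * 2^-1 ^+ j <= e / 2 /\
    `|f (x + h) - peval (psum D j) h| <= e / 2.
  have g0 : (2 * B * 2^-1 ^+ m) @[m --> \oo] --> (0 : R).
    have := @cvg_geometric R (2 * B) 2^-1; apply.
    by rewrite gtr0_norm ?invr_gt0 // invf_lt1 // ltr1n.
  have /cvgrPdist_le /(_ _ e3) h1 := hf h hh.
  have /cvgrPdist_le /(_ _ e3) h2 := g0.
  have [j [k1 k2]] := @filter_ex _ _ _ _ (filterI h1 h2).
  exists j; split=> //; apply: le_trans k2; rewrite sub0r normrN; exact: ler_norm.
(* From [m0] on, the box contains every multi-index of [psum D j], so the box sum of its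
   coefficients is exactly [peval (psum D j) h]. *)
pose m0 := (\max_(y <- psum D j) \max_i y.2 i).+1.
near=> m.
have hm : (m0 <= m)%N by near: m; exact: nbhs_infty_ge.
have inb : all (fun y => y.2 \in box m) (psum D j).
  apply/allP => y yD; apply: mem_box => i; apply: leq_trans hm; rewrite ltnS.
  apply: leq_trans (leq_bigmax_seq _ yD isT); exact: leq_bigmax.
rewrite (_ : f (x + h) - _ = (f (x + h) - peval (psum D j) h) -
  \sum_(k <- box m) (c k - pcoef k (psum D j)) * monomial h k); last first.
  rewrite -(sum_pcoef h (box_uniq m) inb) -addrA -opprD -big_split /=.
  by congr (_ - _); apply: eq_bigr => k _; ring.
apply: le_trans (ler_normB _ _) _; rewrite (splitr e); apply: lerD => //.
apply: le_trans hj1; apply: le_trans (key j (box m) h (box_uniq m) hh).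
apply: le_trans (ler_norm_sum _ _ _) _; apply: ler_sum => k _; by rewrite normrM.
Unshelve. all: by end_near.
Qed.

(** * Picard iteration in the polynomial norm *)

Definition pgeo j (mu nu : mpol) : mpol :=
  psum (fun i => pmul (ppow mu (j.-1 - i)) (ppow nu i)) j.

(** [pgeo j mu nu] is the cofactor of mu - nu in mu^j - nu^j, and [pslope] the divided difference of
    y |-> \sum_j L_j y^j between mu and nu. Being a polynomial itself, it can be measured by
    [pnorm]. *)
Definition pslope (L : nat -> mpol) d (mu nu : mpol) : mpol :=
  psum (fun j => pmul (L j) (pgeo j mu nu)) d.

Lemma peval_slope L d mu nu h :
  (peval mu h - peval nu h) * peval (pslope L d mu nu) h =
  \sum_(j < d) peval (L j) h * peval mu h ^+ j - \sum_(j < d) peval (L j) h * peval nu h ^+ j.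
Proof.
rewrite peval_sum mulr_sumr -sumrB; apply: eq_bigr => j _.
rewrite -mulrBr subrXX peval_mul mulrCA peval_sum; congr (_ * (_ * _)).
by apply: eq_bigr => i _; rewrite peval_mul !peval_pow.
Qed.

(** The coefficient of index 0 drops out, that of index 1 is of order [rho], and for j >= 2 each
    product in [pgeo] contains a factor mu or nu, of norm at most [delta]. *)
Lemma pnorm_slope rho (L : nat -> mpol) d mu nu (C delta : R) :
  0 <= rho -> 0 <= delta <= 1 -> 0 <= C ->
  pnorm rho mu <= delta -> pnorm rho nu <= delta ->
  pnorm rho (L 1%N) <= C * rho -> (forall j, (j < d)%N -> pnorm rho (L j) <= C) ->
  pnorm rho (pslope L d mu nu) <= d%:R * (C * rho + C * d%:R * delta).
Proof.
move=> r0 /andP[d0 d1] C0 hmu hnu h1 hC.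
rewrite pnorm_sum (_ : d%:R * _ = \sum_(j < d) (C * rho + C * d%:R * delta)); last first.
  by rewrite sumr_const card_ord mulr_natl.
apply: ler_sum => -[[|[|j]] hj] _ /=; rewrite pnorm_mul.
- by rewrite /pgeo {2}/pnorm big_nil mulr0 addr_ge0 ?mulr_ge0.
- rewrite /pgeo /= pnorm_mul !pnorm_const normr1 !mulr1.
  by apply: le_trans h1 _; rewrite lerDl !mulr_ge0.
apply: (@le_trans _ _ (C * (d%:R * delta))); last first.
  by rewrite mulrA lerDr mulr_ge0.
apply: ler_pM; rewrite ?pnorm_ge0 ?hC // /pgeo pnorm_sum.
apply: (@le_trans _ _ (\sum_(i < j.+2) delta)); last first.
  rewrite sumr_const card_ord -[leLHS]mulr_natl ler_wpM2r // ler_nat; exact: ltnW.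
apply: ler_sum => -[i hi] _ /=; rewrite pnorm_mul !pnorm_pow.
apply: (@le_trans _ _ (delta ^+ (j.+1 - i) * delta ^+ i)).
  by apply: ler_pM; rewrite ?exprn_ge0 ?pnorm_ge0 // lerXn2r ?nnegrE ?pnorm_ge0.
by rewrite -exprD subnK // exprS ler_piMr // exprn_ile1.
Qed.

(* Picard iteration: [picard m] is the m-th iterate and the m-th increment of
   the fixed point equation [y = \sum_j L_j y^j]. *)
Fixpoint picard (L : nat -> mpol) d m : mpol * mpol :=
  if m is m'.+1 then
    let: (mu, D) := picard L d m' in (mu ++ D, pmul D (pslope L d (mu ++ D) mu))
  else ([::], L 0%N).

Lemma picardE L d m : (0 < d)%N -> forall h,
  peval (picard L d m).1 h + peval (picard L d m).2 h =
  \sum_(j < d) peval (L j) h * peval (picard L d m).1 h ^+ j.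
Proof.
case: d => // d _ h; elim: m => [|m] /=.
  have -> : peval [::] h = 0 by rewrite /peval big_nil.
  rewrite add0r big_ord_recl expr0 mulr1 big1 ?addr0 // => i _.
  by rewrite expr0n mulr0.
case: (picard L d.+1 m) => mu D /= IH.
have := peval_slope L d.+1 (mu ++ D) mu h.
rewrite peval_mul peval_cat addrAC subrr add0r => ->.
by rewrite -IH addrC subrK.
Qed.

(** As long as the iterates stay in the ball of radius [delta], each increment is at most half the
    preceding one; the geometric sum 2 B <= delta keeps them there. *)
Lemma picard_bound (L : nat -> mpol) d rho (B delta : R) :
  0 <= rho -> 0 <= B -> 2 * B <= delta -> pnorm rho (L 0%N) <= B ->
  (forall mu nu, pnorm rho mu <= delta -> pnorm rho nu <= delta ->
     pnorm rho (pslope L d mu nu) <= 2^-1) ->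
  forall m, pnorm rho (picard L d m).1 <= 2 * B * (1 - 2^-1 ^+ m) /\
            pnorm rho (picard L d m).2 <= B * 2^-1 ^+ m.
Proof.
move=> r0 B0 Bd hL hS; elim=> [|m] /=.
  by rewrite expr0 subrr mulr0 mulr1 /pnorm big_nil.
case: (picard L d m) => mu D /= [h1 h2].
have p0 : 0 <= (2^-1 : R) ^+ m by rewrite exprn_ge0 // invr_ge0.
have h3 : pnorm rho (mu ++ D) <= 2 * B * (1 - 2^-1 ^+ m.+1).
  rewrite pnorm_cat; apply: le_trans (lerD h1 h2) _.
  by rewrite exprS le_eqVlt; apply/orP; left; apply/eqP; field.
have le1 (y e : R) : 0 <= e -> y <= 2 * B * (1 - e) -> y <= delta.
  move=> e0 hy; apply: le_trans hy _; apply: le_trans Bd.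
  by rewrite ler_piMr ?mulr_ge0 // gerBl.
split=> //; rewrite pnorm_mul exprSr mulrA; apply: ler_pM; rewrite ?pnorm_ge0 //.
apply: hS; [apply: le1 h3|apply: le1 h1] => //; by rewrite exprn_ge0 // invr_ge0.
Qed.

Lemma picard_sum L d m : (picard L d m).1 = psum (fun m => (picard L d m).2) m.
Proof. by elim: m => //= m <-; case: (picard L d m). Qed.

Definition polyfun (g : 'rV[R]_n -> R) : Prop := exists p, forall h, g h = peval p h.

(** At h = 0 the map y |-> A_h(y) has value and derivative 0 at y = 0, so for small h it contracts a
    small ball. The Picard iterates converge geometrically in [pnorm], and their limit is g because
    g is a fixed point inside that ball. *)
Lemma analytic_fixpoint (A : 'rV[R]_n -> {poly R}) d (f g : 'rV[R]_n -> R) (x : 'rV[R]_n) :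
  (forall j, polyfun (fun h => (A h)`_j)) -> (forall h, size (A h) <= d)%N ->
  (A 0)`_0 = 0 -> (A 0)`_1 = 0 ->
  (forall e : R, 0 < e -> exists2 rho : R, 0 < rho &
     forall h, (forall i, `|h 0 i| < rho) -> `|g h| <= e) ->
  (exists2 rho : R, 0 < rho & forall h, (forall i, `|h 0 i| < rho) -> (A h).[g h] = g h) ->
  (forall h, f (x + h) = f x + g h) ->
  real_analytic_at f x.
Proof.
move=> hA hd A0 A1 gc [rg rg0 hg] fg.
have {hd} hd : forall h, (size (A h) <= d.+1)%N by move=> h; exact: leqW.
have [L [L0 L1 LA]] : exists L : nat -> mpol,
    [/\ all (fun x => x.2 != [ffun=> 0%N]) (L 0%N),
        all (fun x => x.2 != [ffun=> 0%N]) (L 1%N) &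
        forall j h, (A h)`_j = peval (L j) h].
  have /choice [L hL] j : exists p, ((j <= 1)%N -> all (fun x => x.2 != [ffun=> 0%N]) p) /\
      forall h, (A h)`_j = peval p h.
    have [p hp] := hA j; case: (leqP j 1) => hj; last by exists p.
    have [|q q1 q2] := @drop_constant_term p.
      by rewrite -hp; case: j hj {hp} => [|[|]].
    by exists q; split => // h; rewrite hp q2.
  by exists L; split => [||j h]; apply hL.
(* The range [d.+2] contains the index 1 even when d = 0. *)
pose C := \sum_(j < d.+2) pnorm 1 (L j).
have CL j : (j < d.+2)%N -> pnorm 1 (L j) <= C.
  move=> hj; rewrite /C (bigD1 (Ordinal hj)) //= lerDl.
  by apply: sumr_ge0 => i _; apply: pnorm_ge0.
have C0 : 0 <= C by apply: sumr_ge0 => i _; apply: pnorm_ge0.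
pose dd : R := d.+1%:R.
have dd1 : 1 <= dd by rewrite /dd ler1n.
have dd0 : 0 < dd by apply: lt_le_trans dd1.
(* With this [delta] the terms of degree at least 2 contribute at most 1/4 to the slope. *)
pose delta := (4 * (dd * dd * (C + 1)))^-1.
have C1 : 0 < C + 1 by rewrite ltr_wpDl.
have del0 : 0 < delta by rewrite invr_gt0 !mulr_gt0.
have delE : dd * (C * dd * delta) <= 4^-1.
  rewrite (_ : dd * _ = C * (dd * dd * delta)); last by ring.
  rewrite (_ : dd * dd * delta = 4^-1 * (C + 1)^-1); last first.
    by rewrite /delta; field; rewrite !gt_eqF.
  by rewrite mulrCA ler_piMr ?invr_ge0 // ler_pdivrMr // mul1r lerDl.
have del1 : delta <= 1.
  by rewrite invf_le1 ?mulr_gt0 // !mulr_ege1 ?ler1n // lerDr.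
have [rc rc0 hc] := gc _ del0.
(* For [rho] <= 1/K the linear term contributes at most 1/4 to the slope, and the first increment,
   of norm at most C rho, is at most delta / 4. *)
pose K := 4 * dd * (C + 1) / delta.
have K1 : 1 <= K.
  rewrite /K ler_pdivlMr // mul1r; apply: le_trans del1 _.
  by rewrite !mulr_ege1 ?ler1n // lerDr.
have K0 : 0 < K by apply: lt_le_trans K1.
pose rho := Num.min (Num.min rg rc) K^-1.
have rho0 : 0 < rho by rewrite !lt_min rg0 rc0 invr_gt0.
have rhoK : rho <= K^-1 by rewrite ge_min lexx orbT.
have rho1 : rho <= 1 by apply: le_trans rhoK _; rewrite invf_le1.
have rhoI : 0 <= rho <= 1 by rewrite (ltW rho0).
have rhoC : 4 * dd * (C + 1) * rho <= delta.
  rewrite -ler_pdivlMl ?mulr_gt0 //; apply: le_trans rhoK _.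
  by rewrite /K invf_div mulrC.
have CrB : C * rho <= delta / 4.
  rewrite ler_pdivlMr //; apply: le_trans rhoC.
  rewrite mulrC mulrA ler_wpM2r ?(ltW rho0) // -mulrA ler_wpM2l //.
  by rewrite -[C]mul1r; apply: ler_pM => //; rewrite ?mul1r ?lerDl.
have slope mu nu : pnorm rho mu <= delta -> pnorm rho nu <= delta ->
    pnorm rho (pslope L d.+1 mu nu) <= 2^-1.
  move=> hmu hnu; apply: le_trans (pnorm_slope (ltW rho0) _ C0 hmu hnu _ _) _.
  - by rewrite (ltW del0).
  - apply: le_trans (pnorm_small rhoI L1) _.
    by rewrite mulrC ler_wpM2r ?(ltW rho0) // CL.
  - by move=> j hj; apply: le_trans (pnorm_le1 _ rhoI) _; rewrite CL // ltnW.
  rewrite -/dd mulrDr (_ : 2^-1 = 4^-1 + 4^-1); last by field.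
  apply: lerD => //.
  suff : 4 * dd * C * rho <= 1 by move=> hh; rewrite -[leRHS]mulr1 ler_pdivlMl // !mulrA.
  apply: le_trans del1; apply: le_trans rhoC.
  rewrite ler_wpM2r ?(ltW rho0) // ler_wpM2l ?mulr_ge0 ?(ltW dd0) //.
  by rewrite lerDl.
have bound := @picard_bound L d.+1 rho (C * rho) delta (ltW rho0)
   (mulr_ge0 C0 (ltW rho0)).
have {}bound : forall m, pnorm rho (picard L d.+1 m).1 <= 2 * (C * rho) * (1 - 2^-1 ^+ m) /\
            pnorm rho (picard L d.+1 m).2 <= (C * rho) * 2^-1 ^+ m.
  apply: bound => //; last first.
    by apply: le_trans (pnorm_small rhoI L0) _; rewrite mulrC ler_wpM2r ?(ltW rho0) // CL.
  by move: CrB del0; lra.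
have mub m : pnorm rho (picard L d.+1 m).1 <= delta.
  have p0 : 0 <= (2^-1 : R) ^+ m by rewrite exprn_ge0 // invr_ge0.
  have [h1 _] := bound m; apply: le_trans h1 _.
  apply: (@le_trans _ _ (2 * (C * rho))); last by move: CrB del0; lra.
  by rewrite ler_piMr ?mulr_ge0 ?(ltW rho0) // gerBl.
(* The constant [f x] occupies index 0; the shift of the increments by one costs the factor 2 in the
   bound below. *)
pose D m := if m is m'.+1 then (picard L d.+1 m').2 else pconst (f x).
apply: (@analytic_of_polys f x rho (`|f x| + 2 * (C * rho)) D) => //.
  case=> [|m] /=.
    by rewrite pnorm_const expr0 mulr1 lerDl !mulr_ge0 ?(ltW rho0).
  have [_ h2] := bound m; apply: le_trans h2 _.
  rewrite exprS [leRHS]mulrA ler_wpM2r ?exprn_ge0 ?invr_ge0 //.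
  by have := normr_ge0 (f x); lra.
move=> h hh.
have DE m : peval (psum D m.+1) h = f x + peval (picard L d.+1 m).1 h.
  rewrite picard_sum !peval_sum big_ord_recl /= peval_const.
  by congr (_ + _); apply: eq_bigr.
have hg' : (A h).[g h] = g h.
  by apply: hg => i; apply: lt_le_trans (hh i) _; rewrite !ge_min lexx.
have gd : `|g h| <= delta.
  by apply: hc => i; apply: lt_le_trans (hh i) _; rewrite !ge_min lexx orbT.
have horE y : (A h).[y] = \sum_(j < d.+1) peval (L j) h * y ^+ j.
  by rewrite (horner_coef_wide _ (hd h)); apply: eq_bigr => j _; rewrite LA.
(* the constant polynomial [g h] turns [peval_slope] into an estimate at [h] *)
have step m : `|g h - peval (picard L d.+1 m).1 h| <= 2^-1 ^+ m * delta.
  elim: m => [|m IH]; first by rewrite expr0 mul1r /= /peval big_nil subr0.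
  have -> : peval (picard L d.+1 m.+1).1 h =
     peval (picard L d.+1 m).1 h + peval (picard L d.+1 m).2 h.
    by rewrite /=; case: (picard L d.+1 m) => mu' D' /=; rewrite peval_cat.
  rewrite picardE // -{1}hg' horE.
  have := peval_slope L d.+1 (pconst (g h)) (picard L d.+1 m).1 h.
  rewrite peval_const => <-; rewrite normrM exprS -mulrA [leLHS]mulrC.
  apply: ler_pM => //.
  apply: le_trans (_ : pnorm rho (pslope L d.+1 (pconst (g h)) (picard L d.+1 m).1) <= _).
    apply: (le_trans (ler_norm_sum _ _ _)); apply: ler_sum => y _; rewrite normrM.
    by rewrite ler_wpM2l // monomial_le // => i; exact: ltW.
  by apply: slope; rewrite ?pnorm_const.
rewrite fg -(cvg_shiftS (fun m => peval (psum D m) h)).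
rewrite (_ : (fun m => _) = fun m => f x + peval (picard L d.+1 m).1 h); last first.
  by apply/funext => m; rewrite DE.
apply: cvgD; first exact: cvg_cst.
apply/cvgrPdist_le => e e0.
have : (delta * 2^-1 ^+ m) @[m --> \oo] --> (0 : R).
  have := @cvg_geometric R delta 2^-1; apply.
  by rewrite gtr0_norm ?invr_gt0 // invf_lt1 // ltr1n.
move=> /cvgrPdist_le /(_ _ e0); apply: filterS => m hm.
by apply: le_trans (step m) _; apply: le_trans hm; rewrite sub0r normrN mulrC ler_norm.
Qed.

(** * Polynomial dependence on parameters *)

Lemma polyfun_ext (f g : 'rV[R]_n -> R) : f =1 g -> polyfun f -> polyfun g.
Proof. by move=> fg [p hp]; exists p => h; rewrite -fg. Qed.

Lemma polyfun_cst (a : R) : polyfun (fun=> a).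
Proof. by exists (pconst a) => h; rewrite peval_const. Qed.

Lemma polyfun_coord i : polyfun (fun h => h 0 i).
Proof.
exists [:: (1, [ffun j => (j == i : nat)])] => h.
rewrite /peval big_seq1 /= mul1r /monomial (bigD1 i) //= ffunE eqxx expr1 big1 ?mulr1 //.
by move=> j hj; rewrite ffunE (negbTE hj) expr0.
Qed.

Lemma polyfunD f g : polyfun f -> polyfun g -> polyfun (fun h => f h + g h).
Proof. by move=> [p hp] [q hq]; exists (p ++ q) => h; rewrite peval_cat hp hq. Qed.

Lemma polyfunM f g : polyfun f -> polyfun g -> polyfun (fun h => f h * g h).
Proof. by move=> [p hp] [q hq]; exists (pmul p q) => h; rewrite peval_mul hp hq. Qed.

Lemma polyfunN f : polyfun f -> polyfun (fun h => - f h).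
Proof.
move=> hf; apply: (@polyfun_ext (fun h => -1 * f h)); first by move=> h; rewrite mulN1r.
by apply: polyfunM => //; exact: polyfun_cst.
Qed.

Lemma polyfun_sum (I : Type) (r : seq I) (P : pred I) (F : I -> 'rV[R]_n -> R) :
  (forall i, P i -> polyfun (F i)) -> polyfun (fun h => \sum_(i <- r | P i) F i h).
Proof.
move=> hF; elim: r => [|i r IH].
  by apply: polyfun_ext (polyfun_cst 0) => h; rewrite big_nil.
case hP : (P i).
  by apply: polyfun_ext (polyfunD (hF i hP) IH) => h; rewrite big_cons hP.
by apply: polyfun_ext IH => h; rewrite big_cons hP.
Qed.

Definition coef_polyfun (P : 'rV[R]_n -> {poly R}) : Prop :=
  forall j, polyfun (fun h => (P h)`_j).

Lemma coef_polyfun_cst (p : {poly R}) : coef_polyfun (fun=> p).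
Proof. by move=> j; exact: polyfun_cst. Qed.

Lemma coef_polyfunD P Q : coef_polyfun P -> coef_polyfun Q ->
  coef_polyfun (fun h => P h + Q h).
Proof.
move=> hP hQ j; apply: polyfun_ext (polyfunD (hP j) (hQ j)) => h.
by rewrite coefD.
Qed.

Lemma coef_polyfunM P Q : coef_polyfun P -> coef_polyfun Q ->
  coef_polyfun (fun h => P h * Q h).
Proof.
move=> hP hQ j; apply: (@polyfun_ext (fun h => \sum_(i < j.+1) (P h)`_i * (Q h)`_(j - i))).
  by move=> h; rewrite coefM.
by apply: polyfun_sum => i _; exact: polyfunM.
Qed.

Lemma coef_polyfun_ext P Q : P =1 Q -> coef_polyfun P -> coef_polyfun Q.
Proof. by move=> e hP j; apply: polyfun_ext (hP j) => h; rewrite e. Qed.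

Lemma coef_polyfun_sum (I : Type) (r : seq I) (F : I -> 'rV[R]_n -> {poly R}) :
  (forall i, coef_polyfun (F i)) -> coef_polyfun (fun h => \sum_(i <- r) F i h).
Proof.
move=> hF; elim: r => [|i r IH].
  by apply: coef_polyfun_ext (coef_polyfun_cst 0) => h; rewrite big_nil.
by apply: coef_polyfun_ext (coef_polyfunD (hF i) IH) => h; rewrite big_cons.
Qed.

Lemma coef_polyfun_prod (I : Type) (r : seq I) (F : I -> 'rV[R]_n -> {poly R}) :
  (forall i, coef_polyfun (F i)) -> coef_polyfun (fun h => \prod_(i <- r) F i h).
Proof.
move=> hF; elim: r => [|i r IH].
  by apply: coef_polyfun_ext (coef_polyfun_cst 1) => h; rewrite big_nil.
by apply: coef_polyfun_ext (coef_polyfunM (hF i) IH) => h; rewrite big_cons.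
Qed.

Lemma coef_polyfun_char_poly m (A : 'rV[R]_n -> 'M[R]_m) :
  (forall i j, polyfun (fun h => A h i j)) -> coef_polyfun (fun h => char_poly (A h)).
Proof.
move=> hA.
have hC i j : coef_polyfun (fun h => char_poly_mx (A h) i j).
  move=> l; apply: (@polyfun_ext
      (fun h => ('X%:M i j : {poly R})`_l - (A h i j *+ (l == 0%N)))).
    by move=> h; rewrite !mxE coefB coefC; case: (l == 0%N).
  apply: polyfunD; first exact: polyfun_cst.
  apply: polyfunN; case: eqP => _ /=.
    by apply: polyfun_ext (hA i j) => h; rewrite mulr1n.
  by apply: polyfun_ext (polyfun_cst 0) => h; rewrite mulr0n.
rewrite /char_poly /determinant.
apply: coef_polyfun_sum => s; apply: coef_polyfunM; first exact: coef_polyfun_cst.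
apply: coef_polyfun_prod => i; exact: hC.
Qed.

(** The map y |-> y - P_h(f x + y) / P_0'(f x) has f(x + h) - f x as a fixed point, and at h = 0 its
    value and derivative at 0 vanish. Continuity of f places this fixed point in the contraction
    ball. *)
Lemma analytic_simple_root (P : 'rV[R]_n -> {poly R}) d (f : 'rV[R]_n -> R)
    (x : 'rV[R]_n) :
  coef_polyfun P -> (forall h, size (P h) <= d)%N ->
  (forall e : R, 0 < e -> exists2 rho : R, 0 < rho &
     forall h, (forall i, `|h 0 i| < rho) -> `|f (x + h) - f x| <= e) ->
  (exists2 rho : R, 0 < rho &
     forall h, (forall i, `|h 0 i| < rho) -> root (P h) (f (x + h))) ->
  (P 0)^`().[f x] != 0 ->
  real_analytic_at f x.
Proof.
move=> hP hd fc [rr rr0 hr] al0.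
pose T : {poly R} := 'X + (f x)%:P; pose al := (P 0)^`().[f x].
have sT : size T = 2 by rewrite /T size_XaddC.
(* Newton's map at the base point, with the root moved to 0 *)
pose A h : {poly R} := 'X - al^-1 *: (P h \Po T).
have PT h : P h \Po T = \sum_(i < d) (P h)`_i *: T ^+ i.
  rewrite comp_polyE (big_ord_widen _ (fun i => (P h)`_i *: T ^+ i) (hd h)) big_mkcond.
  by apply: eq_bigr => i _; case: ltnP => // hi; rewrite nth_default // scale0r.
have hor h y : (P h \Po T).[y] = (P h).[f x + y].
  by rewrite horner_comp hornerD hornerX hornerC addrC.
apply: (@analytic_fixpoint A (maxn 2 d) f (fun h => f (x + h) - f x) x).
- move=> j; apply: (@polyfun_ext (fun h => 'X`_j - al^-1 *
      \sum_(i < d) (P h)`_i * (T ^+ i)`_j)).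
    move=> h; rewrite /A PT coefB coefZ coef_sum; congr (_ - _ * _).
    by apply: eq_bigr => i _; rewrite coefZ.
  apply: polyfunD; first exact: polyfun_cst.
  apply: polyfunN; apply: polyfunM; first exact: polyfun_cst.
  by apply: polyfun_sum => i _; apply: polyfunM; [exact: hP|exact: polyfun_cst].
- move=> h; apply: leq_trans (size_polyD _ _) _; rewrite size_polyN size_polyX geq_max leq_maxl /=.
  apply: leq_trans (size_scale_leq _ _) _.
  by apply: leq_trans (size_comp_poly_leq _ _) _; rewrite sT muln1; have := hd h; lia.
- rewrite -horner_coef0 /A hornerD hornerN hornerZ hornerX hor addr0 sub0r.
  have hr0 : root (P 0) (f x) by rewrite -[x]addr0 hr // => i; rewrite mxE normr0.
  by rewrite (rootP hr0) mulr0 oppr0.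
- have -> : (A 0)`_1 = (A 0)^`()`_0 by rewrite coef_deriv mulr1n.
  rewrite -horner_coef0 /A derivB derivX derivZ deriv_comp /T derivD derivX derivC addr0 mulr1.
  rewrite hornerD hornerN hornerZ hornerC horner_comp hornerD hornerX hornerC add0r.
  by rewrite -/al mulVf // subrr.
- exact: fc.
- exists rr => // h hh; rewrite /A hornerD hornerN hornerZ hornerX hor addrCA subrr addr0.
  by rewrite (rootP (hr h hh)) mulr0 subr0.
- by move=> h; rewrite [RHS]addrC subrK.
Qed.

End PolynomialFunctions.

(** * The Jacobi matrix and its middle eigenvalue *)

Section Jacobi.
Variables (R : realType) (N : nat).
Local Notation p := (N.*2.+1).
Implicit Types (x v w : 'rV[R]_p) (t b : R).

(** Extension by 0 beyond the last site, so that the eigenvector recursion has no special case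
    there. *)
Definition ext_row x (k : nat) : R := if (k < p)%N then x 0 (inord k) else 0.

Lemma ext_row_ord x (i : 'I_p) : ext_row x i = x 0 i.
Proof. by rewrite /ext_row ltn_ord inord_val. Qed.

Lemma jacobi_row t b v x (j : 'I_p) :
  (x *m jacobi t b v) 0 j = v 0 j * x 0 j +
    (if j : nat is j'.+1 then offdiag t b j * ext_row x j' else 0) +
    offdiag t b j.+1 * ext_row x j.+1.
Proof.
rewrite mxE (eq_bigr (fun i : 'I_p => (if i == j :> nat then v 0 j * x 0 j else 0) +
    (if i.+1 == j then offdiag t b j * ext_row x i else 0) +
    (if i == j.+1 :> nat then offdiag t b i * ext_row x i else 0))); last first.
  move=> i _; rewrite mxE ext_row_ord -(inj_eq val_inj) /= [j == i.+1 :> nat]eq_sym.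
  case: eqP => [/val_inj ->|ne].
    by rewrite mulrC !ifF ?addr0 //; apply/negbTE; rewrite neq_ltn ltnS leqnn ?orbT.
  rewrite add0r; case: eqP => [e|ne2]; last first.
    by rewrite add0r; case: eqP; rewrite ?mulr0 // mulrC.
  by rewrite -e ifF ?addr0 1?mulrC //; apply/negbTE; rewrite neq_ltn; lia.
rewrite !big_split /= -!big_mkcond /=.
rewrite (big_ord1_eq _ (fun=> v 0 j * x 0 j)) ltn_ord.
rewrite (big_ord1_eq _ (fun i => offdiag t b i * ext_row x i)); congr (_ + _ + _).
  case: j => -[|j] hj /=; first by rewrite big_pred0.
  under eq_bigl do rewrite eqSS.
  by rewrite (big_ord1_eq _ (fun i => offdiag t b j.+1 * ext_row x i)) ltnW.
by rewrite /ext_row; case: ltnP => _; rewrite ?mulr0.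
Qed.

Lemma offdiag_bound t b n : 0 <= offdiag t b n <= 2.
Proof.
rewrite /offdiag; case: ifP => _; last by rewrite ler01 ler1n.
by rewrite mulr_ge0 //= ler_piMr // ler_norml cos_geN1 cos_le1.
Qed.

Definition psi t b (i : nat) : R :=
  if odd i then 0 else \prod_(m < i./2) (- offdiag t b m.*2.+1).

Lemma psi0 t b : psi t b 0 = 1.
Proof. by rewrite /psi /= big_ord0. Qed.

Lemma psiS t b m : psi t b m.+1.*2 = - offdiag t b m.*2.+1 * psi t b m.*2.
Proof.
by rewrite /psi !odd_double !doubleK big_ord_recr /= mulrC.
Qed.

Lemma psi_bound t b (i : 'I_p) : `|psi t b i| <= 3 ^+ N.
Proof.
rewrite /psi; case: ifP => _; first by rewrite normr0 exprn_ge0.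
apply: (@le_trans _ _ (3 ^+ i./2)); last first.
  by rewrite ler_eXn2l ?ltr1n //; have := ltn_ord i; lia.
rewrite normr_prod -[leRHS](_ : \prod_(m < i./2) 3 = _); last first.
  by rewrite prodr_const card_ord.
apply: ler_prod => m _; rewrite normr_ge0 normrN /=.
have /andP[a0 a2] := offdiag_bound t b m.*2.+1; rewrite ger0_norm //.
by apply: le_trans a2 _; rewrite ler_nat.
Qed.

(** Rows of odd index determine the even entries upwards from [phi 0 0]; rows of even index
    determine the odd entries downwards from the 0 beyond the end. The entry solved for always has
    coefficient 1, so vanishing a_n do no harm. Each step multiplies the error by at most 2 and adds
    [eta], whence the powers of 3. *)
Lemma eigenvector_close t b v (rho la S : R) (phi : 'rV[R]_p) :
  (forall i, `|v 0 i| <= rho) -> `|la| <= rho -> phi *m jacobi t b v = la *: phi ->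
  (forall i, `|phi 0 i| <= S) ->
  forall i : 'I_p, `|phi 0 i - phi 0 0 * psi t b i| <= 3 ^+ N * (2 * rho * S).
Proof.
move=> hv hla hphi hS; set eta := 2 * rho * S.
have S0 : 0 <= S := le_trans (normr_ge0 _) (hS 0).
have r0 : 0 <= rho := le_trans (normr_ge0 _) hla.
have eta0 : 0 <= eta by rewrite !mulr_ge0.
pose f := ext_row phi; pose eps (j : 'I_p) := (la - v 0 j) * phi 0 j.
have epsb j : `|eps j| <= eta.
  rewrite /eps /eta normrM; apply: ler_pM => //.
  by apply: le_trans (ler_normB _ _) _; rewrite mulr_natl mulr2n lerD.
have eqn (j : 'I_p) : (if j : nat is j'.+1 then offdiag t b j * f j' else 0) +
    offdiag t b j.+1 * f j.+1 = eps j.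
  have /(congr1 (fun M : 'rV[R]_p => M 0 j)) := hphi; rewrite jacobi_row !mxE /eps => e.
  by rewrite mulrBl -e -[X in X - _]addrA [RHS]addrAC subrr add0r.
have up m : (m <= N)%N -> `|f m.*2 - f 0%N * psi t b m.*2| <= 3 ^+ m * eta.
  elim: m => [|m IH] hm; first by rewrite psi0 mulr1 subrr normr0 mulr_ge0 // exprn_ge0.
  have hj : (m.*2.+1 < p)%N by lia.
  have := eqn (Ordinal hj); have := epsb (Ordinal hj); move: (eps _) => e he /=.
  rewrite {2}/offdiag /= odd_double /= mul1r => ee.
  have -> : f m.+1.*2 - f 0%N * psi t b m.+1.*2 =
      e - offdiag t b m.*2.+1 * (f m.*2 - f 0%N * psi t b m.*2).
    by rewrite psiS doubleS -ee; ring.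
  have {}IH := IH (ltnW hm).
  have /andP[a0 a2] := offdiag_bound t b m.*2.+1.
  apply: le_trans (ler_normB _ _) _; rewrite normrM (ger0_norm a0).
  have h3 : offdiag t b m.*2.+1 * `|f m.*2 - f 0%N * psi t b m.*2| <= 2 * (3 ^+ m * eta).
    exact: ler_pM.
  apply: le_trans (lerD he h3) _; rewrite exprS.
  have : eta <= 3 ^+ m * eta by rewrite ler_peMl // exprn_ege1 // ler1n.
  lra.
have down k : (k <= N)%N -> `|f (N - k).*2.+1| <= 3 ^+ k * eta.
  elim: k => [|k IH] hk.
    by rewrite subn0 /f /ext_row ltnn normr0 mulr_ge0 // exprn_ge0.
  have hj : ((N - k).*2 < p)%N by lia.
  have := eqn (Ordinal hj); have := epsb (Ordinal hj); move: (eps _) => e he /=.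
  have -> : (N - k).*2 = ((N - k.+1).*2.+1).+1 by lia.
  rewrite {1}/offdiag /= odd_double /= mul1r => ee.
  have E : (N - k.+1).*2.+3 = (N - k).*2.+1 by lia.
  rewrite E in ee.
  have -> : f (N - k.+1).*2.+1 = e - offdiag t b (N - k).*2.+1 * f (N - k).*2.+1.
    by rewrite -ee; ring.
  have {}IH := IH (ltnW hk).
  have /andP[a0 a2] := offdiag_bound t b (N - k).*2.+1.
  apply: le_trans (ler_normB _ _) _; rewrite normrM (ger0_norm a0).
  have h3 : offdiag t b (N - k).*2.+1 * `|f (N - k).*2.+1| <= 2 * (3 ^+ k * eta).
    exact: ler_pM.
  apply: le_trans (lerD he h3) _; rewrite exprS.
  have : eta <= 3 ^+ k * eta by rewrite ler_peMl // exprn_ege1 // ler1n.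
  lra.
move=> i; rewrite -!ext_row_ord -/f.
have mono k : (k <= N)%N -> 3 ^+ k * eta <= 3 ^+ N * eta.
  by move=> hk; rewrite ler_wpM2r // ler_eXn2l // ltr1n.
have [oi|ei] := boolP (odd i).
  rewrite {1}/psi oi mulr0 subr0.
  have hi : (i./2 < N)%N by have := ltn_ord i; lia.
  have -> : (i : nat) = (N - (N - i./2)).*2.+1 by lia.
  by apply: le_trans (down _ _) (mono _ _); lia.
have -> : (i : nat) = (i./2).*2 by lia.
by apply: le_trans (up _ _) (mono _ _); have := ltn_ord i; lia.
Qed.

(** [eigenvector_close] is applied with S the largest modulus of an entry of phi. For small [rho]
    the error is absorbed into S, which leaves S <= 2 K |phi_0|. *)
Lemma eigenvector_near_psi t b v (rho la : R) (phi : 'rV[R]_p) :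
  4 * 3 ^+ N * rho <= 1 ->
  (forall i, `|v 0 i| <= rho) -> `|la| <= rho -> phi *m jacobi t b v = la *: phi ->
  phi != 0 -> phi 0 0 != 0 /\
  (phi 0 0 = 1 -> forall i : 'I_p, `|phi 0 i - psi t b i| <= 4 * (3 ^+ N) ^+ 2 * rho).
Proof.
move=> hr hv hla hphi phi0; set K := 3 ^+ N in hr *.
have K1 : 1 <= K by rewrite exprn_ege1 // ler1n.
have r0 : 0 <= rho := le_trans (normr_ge0 _) hla.
have [i0 hi0] : exists i0, forall i, `|phi 0 i| <= `|phi 0 i0|.
  exists [arg max_(i > 0) `|phi 0 i|]%O; case: arg_maxP => // i _ h j; exact: h.
have cl := eigenvector_close hv hla hphi hi0.
have hS : `|phi 0 i0| <= 2 * K * `|phi 0 0|.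
  have h1 : `|phi 0 i0| <= `|phi 0 0| * K + K * (2 * rho * `|phi 0 i0|).
    rewrite -{1}[phi 0 i0](subrK (phi 0 0 * psi t b i0)) addrC.
    apply: le_trans (ler_normD _ _) _; apply: lerD => //.
    by rewrite normrM ler_wpM2l // psi_bound.
  have h2 : 4 * K * rho * `|phi 0 i0| <= `|phi 0 i0| by rewrite ler_piMl.
  by move: h1 h2; set y := `|phi 0 i0|; set z := `|phi 0 0|; nra.
split.
  apply: contraNneq phi0 => e0; apply/eqP/rowP => i; rewrite mxE; apply/eqP.
  by rewrite -normr_le0; apply: le_trans (hi0 i) _; rewrite e0 normr0 mulr0 in hS.
move=> e1 i; have := cl i; rewrite e1 mul1r => /le_trans; apply.
rewrite e1 normr1 mulr1 in hS.
have -> : 4 * K ^+ 2 * rho = K * (2 * rho * (2 * K)) by ring.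
by rewrite ler_wpM2l ?(le_trans _ K1) // ler_wpM2l // mulr_ge0.
Qed.

(** * Trial subspaces, size and simplicity of the middle eigenvalue *)

Definition coordmx k (f : 'I_k -> 'I_p) : 'M[R]_(k, p) := rowsub f 1%:M.

Lemma rank_coordmx k (f : 'I_k -> 'I_p) : injective f -> \rank (coordmx f) = k.
Proof.
move=> fi; apply/eqP; rewrite -/(row_free (coordmx f)); apply/row_freeP.
exists (coordmx f)^T; apply/matrixP => i j; rewrite !mxE (bigD1 (f i)) //= big1 ?addr0.
  by rewrite !mxE eqxx mul1r (inj_eq fi) eq_sym.
by move=> l hl; rewrite !mxE eq_sym (negbTE hl) mul0r.
Qed.

Lemma sub_coordmx k (f : 'I_k -> 'I_p) x j : (x <= coordmx f)%MS ->
  (forall i, f i != j) -> x 0 j = 0.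
Proof.
case/submxP => z -> hj; rewrite mxE big1 // => i _; rewrite !mxE (negbTE (hj i)) mulr0 //.
Qed.

Lemma even_index_lt (i : 'I_N.+1) : (i.*2 < p)%N.
Proof. by have := ltn_ord i; lia. Qed.

Definition even_index (i : 'I_N.+1) : 'I_p := Ordinal (even_index_lt i).

Lemma even_index_inj : injective even_index.
Proof. by move=> i j /(congr1 val) /= e; apply: val_inj => /=; lia. Qed.

Lemma qform_even t b v x : (forall j : 'I_p, odd j -> x 0 j = 0) ->
  qform (jacobi t b v) x = \sum_j v 0 j * x 0 j ^+ 2.
Proof.
move=> hx; apply: eq_bigr => j _; have [/hx ->|ej] := boolP (odd j).
  by rewrite expr0n !mulr0.
rewrite jacobi_row.
have hxn k : odd k -> ext_row x k = 0.
  by rewrite /ext_row; case: ltnP => // hk ok; rewrite hx // inordK.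
rewrite hxn ?mulr0 ?addr0 /= ?ej //.
case: j ej => -[|j] hj /= ej; first by rewrite addr0 expr2 mulrA.
by rewrite hxn ?mulr0 ?addr0 ?expr2 ?mulrA //; move: ej; rewrite negbK.
Qed.

(** The span of the even coordinates has dimension N + 1 in a space of dimension 2N + 1, just enough
    for both min-max bounds at index N. *)
Lemma lambda0_bound t b v (rho : R) : (forall i, `|v 0 i| <= rho) ->
  `|lambda0 t b v| <= rho.
Proof.
move=> hv; rewrite ler_norml.
have evE x : (x <= coordmx even_index)%MS -> forall j : 'I_p, odd j -> x 0 j = 0.
  move=> hx j oj; apply: (sub_coordmx hx) => i; apply/eqP => e; move: oj.
  by rewrite -e /= odd_double.
have rk := rank_coordmx even_index_inj.
apply/andP; split.
- apply: (@minmax_ge _ _ _ _ (coordmx even_index)); rewrite ?jacobi_sym ?rk //; try lia.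
  move=> x /evE hx; rewrite (qform_even _ _ _ hx) /sqn mulr_sumr; apply: ler_sum => j _.
  by rewrite ler_wpM2r ?sqr_ge0 //; have := hv j; rewrite ler_norml => /andP[].
- apply: (@minmax_le _ _ _ _ (coordmx even_index)); rewrite ?jacobi_sym ?rk //; try lia.
  move=> x /evE hx; rewrite (qform_even _ _ _ hx) /sqn mulr_sumr; apply: ler_sum => j _.
  by rewrite ler_wpM2r ?sqr_ge0 //; have := hv j; rewrite ler_norml => /andP[].
Qed.

Lemma lambda0_in_spectrum t b v :
  lambda0 t b v \in ordered_eigenvalues (jacobi t b v).
Proof. by rewrite mem_nth // size_ordered_eigenvalues ?jacobi_sym //; lia. Qed.

Lemma lambda0_root t b v : root (char_poly (jacobi t b v)) (lambda0 t b v).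
Proof.
have [_ ->] := ordered_eigenvaluesP (jacobi_sym t b v).
by rewrite root_prod_XsubC lambda0_in_spectrum.
Qed.

Lemma lambda0_eigenvector t b v (rho : R) :
  4 * 3 ^+ N * rho <= 1 -> (forall i, `|v 0 i| <= rho) ->
  exists phi : 'rV[R]_p, [/\ phi *m jacobi t b v = lambda0 t b v *: phi, phi 0 0 = 1 &
    forall i : 'I_p, `|phi 0 i - psi t b i| <= 4 * (3 ^+ N) ^+ 2 * rho].
Proof.
move=> hr hv; have := lambda0_root t b v; rewrite -eigenvalue_root_char => /eigenvalueP.
case=> phi hphi phi0; have hl := lambda0_bound t b hv.
have [p0 _] := eigenvector_near_psi hr hv hl hphi phi0.
exists ((phi 0 0)^-1 *: phi).
have e1 : ((phi 0 0)^-1 *: phi) 0 0 = 1 by rewrite mxE mulVf.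
have e2 : ((phi 0 0)^-1 *: phi) *m jacobi t b v = lambda0 t b v *: ((phi 0 0)^-1 *: phi).
  by rewrite -scalemxAl hphi !scalerA mulrC.
split=> //; apply: (eigenvector_near_psi hr hv hl e2 _).2 => //.
by rewrite scaler_eq0 negb_or invr_eq0 p0.
Qed.

(** Two orthonormal eigenvectors for [lambda0] would have a nontrivial combination with first entry
    0, which [eigenvector_near_psi] excludes. *)
Lemma lambda0_simple t b v (rho : R) :
  4 * 3 ^+ N * rho <= 1 -> (forall i, `|v 0 i| <= rho) ->
  (char_poly (jacobi t b v))^`().[lambda0 t b v] != 0.
Proof.
move=> hr hv; have sJ := jacobi_sym t b v.
have [Q [d [QQ JE]]] := real_spectral sJ.
have := lambda0_in_spectrum t b v.
rewrite (perm_mem (ordered_eigenvalues_perm sJ QQ JE)) => /mapP [i _ li].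
rewrite li; apply: (simple_eigenvalue QQ JE) => j ji; apply/eqP => dji.
have hl := lambda0_bound t b hv.
have qq k l : row k Q *m (row l Q)^T = (k == l)%:R%:M.
  rewrite mul_row_tr; congr (_%:M).
  have /matrixP /(_ k l) := QQ; rewrite !mxE => <-.
  by apply: eq_bigr => m _; rewrite !mxE.
have qn k : row k Q != 0.
  apply/eqP => q0; have := qq k k; rewrite q0 mul0mx eqxx => /(congr1 (fun M : 'M[R]_1 => M 0 0)).
  by rewrite !mxE => /esym/eqP; rewrite oner_eq0.
have qe k : d 0 k = d 0 i -> row k Q *m jacobi t b v = lambda0 t b v *: row k Q.
  by move=> e; rewrite (spectral_eigenvector k QQ JE) e li.
have q0 k : d 0 k = d 0 i -> row k Q 0 0 != 0.
  by move=> e; have [] := eigenvector_near_psi hr hv hl (qe k e) (qn k).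
pose x := row j Q 0 0 *: row i Q - row i Q 0 0 *: row j Q.
have xe : x *m jacobi t b v = lambda0 t b v *: x.
  by rewrite mulmxBl -!scalemxAl !qe // scalerBr !scalerA ![_ * lambda0 _ _ _]mulrC.
have x0 : x = 0.
  apply/eqP/negPn/negP => xn; have [] := eigenvector_near_psi hr hv hl xe xn.
  by rewrite /x !mxE mulrC subrr eqxx.
have := congr1 (mulmx^~ (row i Q)^T) x0.
rewrite mulmxBl -!scalemxAl !qq eqxx (negbTE ji) mul0mx.
move=> /(congr1 (fun M : 'M[R]_1 => M 0 0)); rewrite !mxE eqxx !mulr1n mulr0 subr0 mulr1.
by move/eqP; apply/negP; have := q0 j dji; rewrite mxE.
Qed.

(** * Strict differentiability and analyticity of the middle eigenvalue *)

Definition grad t b (i : 'I_p) : R := psi t b i ^+ 2 / \sum_(j < p) psi t b j ^+ 2.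

Lemma sum_psi_ge1 t b : 1 <= \sum_(j < p) psi t b j ^+ 2.
Proof.
rewrite (bigD1 0) //= psi0 expr1n lerDl; apply: sumr_ge0 => i _; exact: sqr_ge0.
Qed.

Lemma jacobiB t b v w : jacobi t b v - jacobi t b w = diag_mx (v - w).
Proof.
apply/matrixP => i j; rewrite !mxE; case: eqP => [->|_]; first by rewrite mulr1n.
by rewrite subrr mulr0n.
Qed.

(* If phi and chi are eigenvectors for v and w, pairing phi J(v) = la phi with
   chi, and phi with J(w) chi = mu chi, gives
   (la - mu) <phi, chi> = \sum_i (v_i - w_i) phi_i chi_i. *)
Lemma lambda0_strict_derivative t b (e : R) : 0 < e ->
  exists2 rho : R, 0 < rho & forall v w,
    (forall i, `|v 0 i| <= rho) -> (forall i, `|w 0 i| <= rho) ->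
    exists2 m : 'I_p -> R,
      lambda0 t b v - lambda0 t b w = \sum_i (v 0 i - w 0 i) * m i &
      forall i, `|m i - grad t b i| <= e.
Proof.
move=> e0; pose K : R := 3 ^+ N.
have K1 : 1 <= K by rewrite exprn_ege1 // ler1n.
pose P : R := p%:R.
have P1 : 1 <= P by rewrite ler1n.
(* [sg] will bound |phi_i chi_i - psi_i^2|. The first term of the minimum keeps <phi, chi> at least
   1/2, the second makes the final error at most e. *)
pose sg := Num.min (2 * P)^-1 (e / (2 * (1 + P))).
have sg0 : 0 < sg by rewrite lt_min invr_gt0 divr_gt0 ?mulr_gt0 //; lra.
have sgP : P * sg <= 2^-1.
  rewrite -ler_pdivlMl; last lra.
  by rewrite -invfM [P * 2]mulrC /sg ge_min lexx.
have sge : 2 * (1 + P) * sg <= e.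
  by rewrite mulrC -ler_pdivlMr ?mulr_gt0 //; [rewrite ge_min lexx orbT|lra].
(* [ka] = 4 K^2 rho bounds the distance of phi and chi from psi entrywise, so that the products
   deviate by at most ka^2 + 2 K ka <= sg. *)
pose ka := Num.min 1 (sg / (2 * K + 1)).
have ka0 : 0 < ka by rewrite lt_min ltr01 divr_gt0 //; lra.
have ka1 : ka <= 1 by rewrite ge_min lexx.
have kasg : ka * (2 * K + 1) <= sg.
  by rewrite -ler_pdivlMr; [rewrite ge_min lexx orbT|lra].
exists (ka / (4 * K ^+ 2)); first by rewrite divr_gt0 // mulr_gt0 // exprn_gt0 //; lra.
set rho := ka / _; move=> v w hv hw.
have K2 : 0 < K ^+ 2 by rewrite exprn_gt0 //; lra.
have rhoE : 4 * K ^+ 2 * rho = ka by rewrite /rho; field; rewrite gt_eqF //; lra.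
have rho0 : 0 <= rho by rewrite divr_ge0 ?(ltW ka0) // mulr_ge0 // ltW.
have hr : 4 * K * rho <= 1.
  apply: le_trans ka1; rewrite -rhoE ler_wpM2r // ler_wpM2l // expr2 ler_peMl //; lra.
have [phi [phiE phi1 phin]] := lambda0_eigenvector t b hr hv.
have [chi [chiE chi1 chin]] := lambda0_eigenvector t b hr hw.
rewrite -/K rhoE in phin chin.
have cl (i : 'I_p) : `|phi 0 i * chi 0 i - psi t b i ^+ 2| <= sg.
  have -> : phi 0 i * chi 0 i - psi t b i ^+ 2 = (phi 0 i - psi t b i) * (chi 0 i - psi t b i)
     + psi t b i * (phi 0 i - psi t b i) + psi t b i * (chi 0 i - psi t b i) by ring.
  apply: le_trans kasg; apply: (@le_trans _ _ (ka * ka + K * ka + K * ka)); last first.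
    by move: ka1 ka0; nra.
  apply: le_trans (ler_normD _ _) _; apply: lerD; last first.
    by rewrite normrM; apply: ler_pM => //; exact: psi_bound.
  apply: le_trans (ler_normD _ _) _; apply: lerD; rewrite normrM; apply: ler_pM => //.
  exact: psi_bound.
set g := \sum_(j < p) psi t b j ^+ 2; have g1 : 1 <= g := sum_psi_ge1 t b.
pose G := \sum_i phi 0 i * chi 0 i.
have Gg : `|G - g| <= P * sg.
  rewrite /G /g -sumrB; apply: le_trans (ler_norm_sum _ _ _) _.
  rewrite (_ : P * sg = \sum_(i < p) sg); first by apply: ler_sum => i _; exact: cl.
  by rewrite sumr_const card_ord mulr_natl.
have G2 : 2^-1 <= G by move: Gg; rewrite ler_norml => /andP[? _]; lra.
have main : (lambda0 t b v - lambda0 t b w) * G = \sum_i (v 0 i - w 0 i) * (phi 0 i * chi 0 i).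
  have : phi *m (jacobi t b v - jacobi t b w) *m chi^T =
      (lambda0 t b v - lambda0 t b w) *: (phi *m chi^T).
    rewrite mulmxBr mulmxBl phiE -scalemxAl scalerBl; congr (_ - _).
    by rewrite -mulmxA -[jacobi t b w]jacobi_sym -trmx_mul chiE linearZ /= -scalemxAr.
  rewrite jacobiB !mul_row_tr scale_scalar_mx => /(congr1 (fun M : 'M[R]_1 => M 0 0)).
  rewrite !mxE !mulr1n => <-; apply: eq_bigr => i _.
  by rewrite mul_mx_diag !mxE; ring.
have Gn0 : G != 0 by rewrite gt_eqF //; lra.
exists (fun i => phi 0 i * chi 0 i / G).
  apply: (mulIf Gn0); rewrite main mulr_suml; apply: eq_bigr => i _; by field.
move=> i; rewrite /grad -/g.
have pg : psi t b i ^+ 2 <= g.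
  rewrite /g (bigD1 i) //= lerDl; apply: sumr_ge0 => j _; exact: sqr_ge0.
have gn0 : g != 0 by rewrite gt_eqF //; lra.
have -> : phi 0 i * chi 0 i / G - psi t b i ^+ 2 / g =
    (phi 0 i * chi 0 i - psi t b i ^+ 2) / G + psi t b i ^+ 2 / g * ((g - G) / G).
  by field; rewrite ?gn0 ?Gn0.
have Gi : G^-1 <= 2 by rewrite -[2]invrK lef_pV2 ?posrE ?invr_gt0 //; lra.
have Gi0 : 0 <= G^-1 by rewrite invr_ge0; lra.
apply: le_trans sge; apply: le_trans (ler_normD _ _) _.
have -> : 2 * (1 + P) * sg = sg * 2 + 1 * (P * sg * 2) by ring.
apply: lerD; rewrite normrM.
  by apply: ler_pM => //; rewrite ger0_norm.
apply: ler_pM => //.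
  rewrite ger0_norm ?divr_ge0 ?sqr_ge0 //; last lra.
  by rewrite ler_pdivrMr ?mul1r //; lra.
by rewrite normrM; apply: ler_pM => //; rewrite ?(ger0_norm Gi0) // distrC.
Qed.

Lemma grad_bound t b i : 0 <= grad t b i <= 1.
Proof.
have g1 := sum_psi_ge1 t b; rewrite divr_ge0 ?sqr_ge0 //=; last lra.
rewrite ler_pdivrMr ?mul1r; last lra.
rewrite (bigD1 i) //= lerDl; apply: sumr_ge0 => j _; exact: sqr_ge0.
Qed.

Lemma Vodd_of_le (u : 'rV[R]_N.+1) (c : R) : 0 <= c -> (forall i, `|u 0 i| <= c) ->
  forall i, `|Vodd_of u 0 i| <= c.
Proof. by move=> c0 hu i; rewrite mxE; case: ifP => //; rewrite normr0. Qed.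

Lemma Vodd_ofD (u h : 'rV[R]_N.+1) : Vodd_of (u + h) = Vodd_of u + Vodd_of h.
Proof. by apply/rowP => i; rewrite !mxE; case: ifP => //; rewrite ?addr0 ?mxE. Qed.

(** [analytic_simple_root] for the characteristic polynomial: continuity comes from the strict
    derivative with error 1, simplicity from [lambda0_simple]. *)
Lemma lambda0_analytic t b :
  exists2 rho : R, 0 < rho & forall u : 'rV[R]_N.+1, (forall i, `|u 0 i| < rho) ->
    real_analytic_at (fun y => lambda0 t b (Vodd_of y)) u.
Proof.
have [r1 r10 hder] := lambda0_strict_derivative t b (@ltr01 R).
have K1 : 1 <= 3 ^+ N :> R by rewrite exprn_ege1 // ler1n.
pose rho := Num.min r1 (4 * 3 ^+ N)^-1.
have rho0 : 0 < rho by rewrite lt_min r10 invr_gt0; lra.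
have rho1 : rho <= r1 by rewrite ge_min lexx.
have rho2 : 4 * 3 ^+ N * rho <= 1.
  by rewrite -ler_pdivlMl ?mulr1; [rewrite ge_min lexx orbT|lra].
exists rho => // u hu.
have [s s0 hs] : exists2 s : R, 0 < s &
    forall h : 'rV[R]_N.+1, (forall i, `|h 0 i| < s) -> forall i, `|(u + h) 0 i| <= rho.
  have [i0 hi0] : exists i0, forall i, `|u 0 i| <= `|u 0 i0|.
    exists [arg max_(i > 0) `|u 0 i|]%O; case: arg_maxP => // i _ h j; exact: h.
  exists (rho - `|u 0 i0|); first by rewrite subr_gt0.
  move=> h hh i; rewrite mxE; apply: le_trans (ler_normD _ _) _.
  by have := hh i; have := hi0 i; lra.
have hu' i : `|u 0 i| <= rho by exact: ltW.
apply: (@analytic_simple_root _ _ (fun h => char_poly (jacobi t b (Vodd_of (u + h)))) p.+1).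
- apply: coef_polyfun_char_poly => i j.
  have [<-|ne] := eqVneq i j.
    apply: (@polyfun_ext _ _ (fun h => Vodd_of (u + h) 0 i)).
      by move=> h; rewrite [RHS]mxE eqxx.
    have [oi|ei] := boolP (odd i).
      by apply: polyfun_ext (@polyfun_cst _ _ 0) => h; rewrite mxE oi.
    apply: (@polyfun_ext _ _ (fun h => u 0 (inord i./2) + h 0 (inord i./2))).
      by move=> h; rewrite !mxE (negbTE ei).
    by apply: polyfunD; [exact: polyfun_cst|exact: polyfun_coord].
  apply: polyfun_ext (@polyfun_cst _ _ (jacobi t b 0 i j)) => h.
  by rewrite !mxE (negbTE ne).
- by move=> h; rewrite size_char_poly.
(* There are p summands, with coefficients at most 2: the gradient is at most 1 and the error at
   most 1. *)
- move=> e e0; exists (Num.min s (e / (2 * p%:R))).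
    by rewrite lt_min s0 divr_gt0 // mulr_gt0.
  move=> h hh.
  have h1 : forall i, `|Vodd_of (u + h) 0 i| <= r1.
    apply: Vodd_of_le => [|i]; first exact: ltW.
    by apply: le_trans rho1; apply: hs => j; apply: lt_le_trans (hh j) _; rewrite ge_min lexx.
  have h2 : forall i, `|Vodd_of u 0 i| <= r1.
    by apply: Vodd_of_le => [|i]; [exact: ltW|apply: le_trans (hu' i) _].
  have [m -> hm] := hder _ _ h1 h2.
  have -> : e = \sum_(i < p) (e / (2 * p%:R) * 2).
    have P0 : (p%:R : R) != 0 by rewrite pnatr_eq0.
    by rewrite sumr_const card_ord -[RHS]mulr_natl; move: (p%:R) P0 => P P0; field.
  apply: le_trans (ler_norm_sum _ _ _) _; apply: ler_sum => i _; rewrite normrM.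
  apply: ler_pM => //.
    rewrite Vodd_ofD [X in X - _]mxE addrAC subrr add0r; apply: Vodd_of_le => [|j].
      by rewrite ltW // divr_gt0 // mulr_gt0.
    by apply/ltW; apply: lt_le_trans (hh j) _; rewrite ge_min lexx orbT.
  have /andP[g0 g1] := grad_bound t b i; have := hm i.
  rewrite !ler_norml => /andP[? ?]; apply/andP; split; lra.
- by exists 1 => // h _; exact: lambda0_root.
- by rewrite addr0; apply: lambda0_simple rho2 _; apply: Vodd_of_le => //; exact: ltW.
Qed.

(** * Large potentials with small middle eigenvalue *)

Definition far_potential (k : R) : 'rV[R]_p :=
  \row_i (if i == ord_max then k else if i == 0 then - k else 0).

Lemma far_potential_Vodd k : Vodd (far_potential k).
Proof.
move=> i oi; rewrite mxE; case: eqP => [e|_].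
  by move: oi; rewrite e /= odd_double.
by case: eqP => // e; move: oi; rewrite e.
Qed.

Lemma far_potential_norm k : 0 <= k -> k <= enorm (far_potential k).
Proof.
move=> k0; rewrite -{1}[k]ger0_norm // -sqrtr_sqr; apply: ler_wsqrtr.
rewrite (bigD1 ord_max) //= mxE eqxx lerDl; apply: sumr_ge0 => i _; exact: sqr_ge0.
Qed.

(** On the support of x every interaction passes through the centre c, and q is the only site
    coupled to c. *)
Lemma qform_star n (A : 'M[R]_n) (c q : 'I_n) (x : 'rV[R]_n) : A^T = A -> q != c ->
  (forall i j, i != c -> j != c -> x 0 i * A i j * x 0 j = 0) ->
  (forall j, j != c -> j != q -> A c j * x 0 j = 0) ->
  qform A x = A c c * x 0 c ^+ 2 + 2 * (A c q * x 0 c * x 0 q).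
Proof.
move=> symA qc h1 h2.
have sA i j : A i j = A j i by rewrite -{1}symA mxE.
rewrite /qform (bigD1 c) //= (bigD1 q) //= big1 ?addr0.
  rewrite mxE (bigD1 c) //= (bigD1 q) //= big1 ?addr0; last first.
    by move=> i /andP[ic iq]; rewrite sA mulrC h2.
  rewrite [(x *m A) 0 q]mxE mulr_suml (bigD1 c) //= big1 ?addr0; last first.
    by move=> i ic; rewrite h1.
  by rewrite (sA q c); ring.
move=> j /andP[jc jq]; rewrite mxE mulr_suml (bigD1 c) //= big1 ?addr0.
  by rewrite -mulrA h2 // mulr0.
by move=> i ic; rewrite h1.
Qed.

(** The site c followed by the N odd sites. The odd sites are mutually uncoupled and [far_potential]
    vanishes on them; c will be an end of the chain, with a single neighbour. *)
Definition star_index (c : 'I_p) (i : 'I_N.+1) : 'I_p :=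
  if i : nat is i'.+1 then inord i'.*2.+1 else c.

Lemma star_index_inj (c : 'I_p) : ~~ odd c -> injective (star_index c).
Proof.
move=> ec [[|i] hi] [[|j] hj]; rewrite /star_index /= => e; apply: val_inj => //=.
- by move: ec; rewrite e inordK /= ?odd_double //; lia.
- by move: ec; rewrite -e inordK /= ?odd_double //; lia.
- by move/(congr1 val): e; rewrite /= !inordK; lia.
Qed.

Lemma star_support (c : 'I_p) x : (x <= coordmx (star_index c))%MS ->
  forall j : 'I_p, ~~ odd j -> j != c -> x 0 j = 0.
Proof.
move=> hx j ej jc; apply: (sub_coordmx hx) => -[[|i] hi]; rewrite /star_index /=.
  by rewrite eq_sym.
by apply: contraNneq ej => <-; rewrite inordK /= ?odd_double //; lia.
Qed.

Lemma far_qform t b k (c q : 'I_p) x : ~~ odd c -> odd q ->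
  (forall j : 'I_p, (j == c.+1 :> nat) || (c == j.+1 :> nat) -> j = q) ->
  (x <= coordmx (star_index c))%MS ->
  exists2 a : R, `|a| <= 2 & qform (jacobi t b (far_potential k)) x =
    far_potential k 0 c * x 0 c ^+ 2 + 2 * (a * x 0 c * x 0 q).
Proof.
move=> ec oq hq /star_support hx.
have qc : q != c by apply: contraNneq ec => <-.
exists (jacobi t b (far_potential k) c q).
  rewrite mxE eq_sym (negbTE qc).
  have ab m : `|offdiag t b m| <= 2.
    by have /andP[a0 a2] := offdiag_bound t b m; rewrite ger0_norm.
  by case: ifP => // _; case: ifP => // _; rewrite normr0.
rewrite (qform_star (jacobi_sym _ _ _) qc); first by rewrite [X in X * _ + _]mxE eqxx.
- move=> i j ic jc.
  have [oi|/hx->//] := boolP (odd i); last by rewrite !mul0r.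
  have [oj|/hx->//] := boolP (odd j); last by rewrite mulr0.
  rewrite (_ : jacobi _ _ _ i j = 0) ?mulr0 ?mul0r // mxE; case: eqP => [_|_].
    rewrite mxE; case: eqP => [e|_]; first by move: oi; rewrite e /= odd_double.
    by case: eqP => // e; move: oi; rewrite e.
  case: eqP => [e|_]; first by move: oj; rewrite e /= oi.
  by case: eqP => // e; move: oi; rewrite e /= oj.
- move=> j jc jq.
  have [oj|/hx->//] := boolP (odd j); last by rewrite mulr0.
  rewrite mxE eq_sym (negbTE jc); case: eqP => [e|_].
    by case/eqP: jq; apply: hq; rewrite e eqxx.
  case: eqP => [e|_]; last by rewrite mul0r.
  by case/eqP: jq; apply: hq; rewrite e eqxx orbT.
Qed.

Lemma sqr_coord_le x (i : 'I_p) : x 0 i ^+ 2 <= sqn x.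
Proof.
rewrite /sqn (bigD1 i) //= lerDl; apply: sumr_ge0 => j _; exact: sqr_ge0.
Qed.

(** Completing the square: k times the form, plus a^2 z^2, equals (k y + a z)^2. *)
Lemma star_form_bound (a k y z s : R) : 0 < k -> `|a| <= 2 -> z ^+ 2 <= s ->
  - (4 / k * s) <= k * y ^+ 2 + 2 * (a * y * z).
Proof.
move=> k0 a2 hz; have a4 : a ^+ 2 <= 4.
  by rewrite -[a ^+ 2]ger0_norm ?sqr_ge0 // normrX (_ : 4 = 2 ^+ 2) ?lerXn2r ?nnegrE //; ring.
rewrite lerNl -(ler_pM2l k0).
have -> : k * (4 / k * s) = 4 * s by field; rewrite gt_eqF.
have s0 : 0 <= z ^+ 2 := sqr_ge0 z.
have h1 : a ^+ 2 * z ^+ 2 <= 4 * s by apply: ler_pM => //; exact: sqr_ge0.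
apply: le_trans h1; rewrite -subr_ge0.
have -> : a ^+ 2 * z ^+ 2 - k * - (k * y ^+ 2 + 2 * (a * y * z)) = (k * y + a * z) ^+ 2.
  by ring.
exact: sqr_ge0.
Qed.

(* With the large values of opposite signs at the two ends, lambda_0 is
   trapped among the N eigenvalues that decay like 1/k. *)
Lemma lambda0_far t b (k : R) : (0 < N)%N -> 0 < k ->
  `|lambda0 t b (far_potential k)| <= 4 / k.
Proof.
move=> N0 k0; rewrite ler_norml; apply/andP; split.
- have em : ~~ odd (ord_max : 'I_p) by rewrite /= odd_double.
  have hq : (N.*2.-1 < p)%N by lia.
  apply: (@minmax_ge _ _ _ _ (coordmx (star_index ord_max))); rewrite ?jacobi_sym //; last lia.
    move=> x hx.
    have [//||j|a a2 ->] := @far_qform t b k ord_max (Ordinal hq) x _ _ _ hx.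
    + by rewrite /=; lia.
    + by move=> hj; apply: val_inj => /=; have := ltn_ord j; move: hj => /=; lia.
    by rewrite mxE eqxx mulNr; apply: star_form_bound => //; exact: sqr_coord_le.
  by rewrite (rank_coordmx (star_index_inj em)); lia.
- have hq : (1 < p)%N by lia.
  apply: (@minmax_le _ _ _ _ (coordmx (star_index 0))); rewrite ?jacobi_sym //.
    move=> x hx.
    have [//|//|j|a a2 ->] := @far_qform t b k 0 (Ordinal hq) x _ _ _ hx.
      by move=> hj; apply: val_inj => /=; move: hj => /=; lia.
    rewrite mxE ifF; last by apply/negbTE; rewrite -(inj_eq val_inj) /=; lia.
    (* At the first site the potential is - k; minus the form is a star form with centre value k and
       coupling - a. *)
    rewrite -[leRHS]opprK lerNr.
    have := @star_form_bound (- a) k (x 0 0) (x 0 (Ordinal hq)) (sqn x) k0.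
    rewrite normrN => /(_ a2 (sqr_coord_le _ _)) /le_trans; apply.
    by rewrite le_eqVlt; apply/orP; left; apply/eqP; ring.
  by rewrite rank_coordmx //; exact: star_index_inj.
Qed.

End Jacobi.

(** * Local inversion *)

(* Registers the join of the complete and normed structures of ['rV[R]_n]. *)
HB.instance Definition _ (R : realType) (n : nat) := Complete.on 'rV[R]_n.

Section LocalInversion.
Variable R : realType.

Lemma coord_le_norm n (x : 'rV[R]_n) i : `|x 0 i| <= `|x|.
Proof.
rewrite [leRHS]mx_normrE.
exact: (le_bigmax 0 (fun ij : 'I_1 * 'I_n => `|x ij.1 ij.2|) (0, i)).
Qed.

Lemma norm_row_le n (x : 'rV[R]_n) (c : R) : 0 <= c -> (forall i, `|x 0 i| <= c) ->
  `|x| <= c.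
Proof.
by move=> c0 hx; rewrite [leLHS]mx_normrE; apply: bigmax_le => // -[i j] _ /=; rewrite ord1.
Qed.

Lemma common_radius n (rho : 'I_n -> R) : (forall j, 0 < rho j) ->
  exists2 r : R, 0 < r & forall j, r <= rho j.
Proof.
move=> h; exists (\big[Num.min/1]_j rho j); last by move=> j; exact: bigmin_le.
by apply: lt_bigmin.
Qed.

Lemma enormE n (v : 'rV[R]_n) : enorm v = Num.sqrt (sqn v).
Proof. by []. Qed.

Lemma enorm_lt n (v : 'rV[R]_n) (r : R) : 0 < r -> (enorm v < r) = (sqn v < r ^+ 2).
Proof.
move=> r0; rewrite enormE -{1}[r]gtr0_norm // -sqrtr_sqr ltr_sqrt //.
by rewrite exprn_gt0.
Qed.

Lemma coord_le_enorm n (v : 'rV[R]_n) i : `|v 0 i| <= enorm v.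
Proof.
rewrite -sqrtr_sqr; apply: ler_wsqrtr; rewrite (bigD1 i) //= lerDl.
by apply: sumr_ge0 => j _; exact: sqr_ge0.
Qed.

Variable N : nat.
Local Notation p := (N.*2.+1).

Lemma sum_Vodd_of (u : 'rV[R]_N.+1) (m : 'I_p -> R) :
  \sum_i Vodd_of u 0 i * m i = \sum_k u 0 k * m (even_index k).
Proof.
rewrite (bigID (fun i : 'I_p => odd i)) /= big1 ?add0r; last first.
  by move=> i oi; rewrite mxE oi mul0r.
rewrite (reindex_onto (@even_index N) (fun i => inord i./2)) /=; last first.
  move=> i ei; apply: val_inj => /=; rewrite inordK; last by have := ltn_ord i; lia.
  by rewrite even_halfK.
apply: eq_big => k; first by rewrite odd_double doubleK inord_val eqxx.
by move=> _; rewrite mxE /= odd_double doubleK inord_val.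
Qed.

Lemma Vodd_ofB (u h : 'rV[R]_N.+1) : Vodd_of (u - h) = Vodd_of u - Vodd_of h.
Proof. by apply/rowP => i; rewrite !mxE; case: ifP => //; rewrite ?subr0 ?mxE. Qed.

(** The Jacobian of [Lambda] at 0 in the coordinates of [Vodd_of], transposed because it acts on row
    vectors. *)
Definition Gmx n (t : 'I_n -> R) b : 'M[R]_(N.+1, n) :=
  \matrix_(k, j) grad (t j) b (even_index k).

Lemma Lambda_strict_derivative n (t : 'I_n -> R) b (e : R) : 0 < e ->
  exists2 rho : R, 0 < rho & forall u w : 'rV[R]_N.+1,
    (forall i, `|u 0 i| <= rho) -> (forall i, `|w 0 i| <= rho) ->
    exists2 M : 'M[R]_(N.+1, n),
      Lambda t b (Vodd_of u) - Lambda t b (Vodd_of w) = (u - w) *m M &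
      forall k j, `|M k j - Gmx t b k j| <= e.
Proof.
move=> e0.
have /choice [rh hrh] j : exists rho : R, 0 < rho /\ forall v w : 'rV[R]_p,
    (forall i, `|v 0 i| <= rho) -> (forall i, `|w 0 i| <= rho) ->
    exists2 m : 'I_p -> R,
      lambda0 (t j) b v - lambda0 (t j) b w = \sum_i (v 0 i - w 0 i) * m i &
      forall i, `|m i - grad (t j) b i| <= e.
  by have [rho r0 h] := @lambda0_strict_derivative R N (t j) b e e0; exists rho.
have [r r0 hr] := common_radius (fun j => (hrh j).1).
exists r => // u w hu hw.
have /choice [m hm] j : exists m : 'I_p -> R,
    lambda0 (t j) b (Vodd_of u) - lambda0 (t j) b (Vodd_of w) =
      \sum_i (Vodd_of u 0 i - Vodd_of w 0 i) * m i /\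
    forall i, `|m i - grad (t j) b i| <= e.
  have [|| m m1 m2] := (hrh j).2 (Vodd_of u) (Vodd_of w); last by exists m.
  - by apply: Vodd_of_le => [|i]; [exact/ltW/(hrh j).1|exact: le_trans (hu i) (hr j)].
  - by apply: Vodd_of_le => [|i]; [exact/ltW/(hrh j).1|exact: le_trans (hw i) (hr j)].
exists (\matrix_(k, j) m j (even_index k)).
  apply/rowP => j; rewrite !mxE (hm j).1.
  rewrite (eq_bigr (fun i => Vodd_of (u - w) 0 i * m j i)).
    by rewrite sum_Vodd_of; apply: eq_bigr => k _; rewrite !mxE.
  by move=> i _; rewrite Vodd_ofB; congr (_ * _); rewrite [RHS]mxE [X in _ = _ + X]mxE.
by move=> k j; rewrite !mxE; exact: (hm j).2.
Qed.

(** Followed by [L], the map is the identity up to a perturbation of Lipschitz constant 1/2. A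
    one-sided inverse suffices, so n may exceed N + 1 as in (iii). *)
Lemma Lambda_expansion n (t : 'I_n -> R) b (L : 'M[R]_(n, N.+1)) :
  Gmx t b *m L = 1%:M ->
  exists2 rho : R, 0 < rho & forall u w : 'rV[R]_N.+1,
    (forall i, `|u 0 i| <= rho) -> (forall i, `|w 0 i| <= rho) ->
    `|(Lambda t b (Vodd_of u) - Lambda t b (Vodd_of w)) *m L - (u - w)| <= 2^-1 * `|u - w|.
Proof.
move=> GL; pose S := \sum_j \sum_l `|L j l|.
have S0 : 0 <= S by do 2!apply: sumr_ge0 => ? _.
pose q : R := N.+1%:R; have q0 : 0 < q by rewrite ltr0n.
(* [S] dominates the absolute column sums of [L], and q coordinates are summed, so this entrywise
   error yields the constant 1/2. *)
have e0 : 0 < (2 * q * (S + 1))^-1 by rewrite invr_gt0 !mulr_gt0 // ltr_wpDl.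
have [rho r0 h] := Lambda_strict_derivative t b e0.
exists rho => // u w hu hw; have [M -> hM] := h u w hu hw.
set d := u - w; have -> : d *m M *m L - d = d *m ((M - Gmx t b) *m L).
  by rewrite [X in _ = _ *m X]mulmxBl GL [RHS]mulmxBr mulmx1 mulmxA.
apply: norm_row_le => [|l]; first by rewrite mulr_ge0 ?invr_ge0.
rewrite mxE; apply: le_trans (ler_norm_sum _ _ _) _.
apply: (@le_trans _ _ (\sum_(k < N.+1) `|d| * ((2 * q * (S + 1))^-1 * S))).
  apply: ler_sum => k _; rewrite normrM; apply: ler_pM => //; first exact: coord_le_norm.
  rewrite mxE; apply: le_trans (ler_norm_sum _ _ _) _; rewrite mulr_sumr.
  apply: ler_sum => j _; rewrite normrM; apply: ler_pM => //.
    by have := hM k j; rewrite [in X in _ -> X]mxE [X in _ -> `|_ + X| <= _]mxE.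
  by rewrite (bigD1 l) //= lerDl; apply: sumr_ge0.
rewrite sumr_const card_ord -[leLHS]mulr_natl -/q.
have -> : q * (`|d| * ((2 * q * (S + 1))^-1 * S)) = 2^-1 * `|d| * (S / (S + 1)).
  by field; rewrite !gt_eqF // ltr_wpDl.
by rewrite ler_piMr ?mulr_ge0 ?invr_ge0 // ler_pdivrMr ?ltr_wpDl // mul1r lerDl.
Qed.

Lemma Vodd_ofP (v : 'rV[R]_p) : Vodd v -> exists2 u : 'rV[R]_N.+1, Vodd_of u = v &
  forall c : R, (forall i, `|v 0 i| <= c) -> forall i, `|u 0 i| <= c.
Proof.
move=> hv; have [_ _ /(_ v hv) [u _ uv]] := Vodd_of_bij R N.
exists u => // c hc k; have := hc (even_index k).
by rewrite -uv mxE /= odd_double doubleK inord_val.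
Qed.

Lemma Lambda_locally_inj n (t : 'I_n -> R) b (L : 'M[R]_(n, N.+1)) :
  Gmx t b *m L = 1%:M ->
  exists2 rho : R, 0 < rho & forall v w : 'rV[R]_p,
    Bodd rho v -> Bodd rho w -> Lambda t b v = Lambda t b w -> v = w.
Proof.
move=> GL; have [rho r0 h] := Lambda_expansion GL; exists rho => //.
move=> _ _ [/Vodd_ofP [u <- hu] nu] [/Vodd_ofP [w <- hw] nw] e.
have bd (x : 'rV[R]_N.+1) : enorm (Vodd_of x) < rho -> forall i, `|Vodd_of x 0 i| <= rho.
  by move=> hx i; apply: le_trans (coord_le_enorm _ _) (ltW hx).
have := h u w (hu _ (bd _ nu)) (hw _ (bd _ nw)).
rewrite e subrr mul0mx sub0r normrN => hn.
suff -> : u = w by [].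
have half (z : R) : z <= 2^-1 * z -> z <= 0 by lra.
by apply/eqP; rewrite -subr_eq0 -normr_le0; exact: half.
Qed.

(** Openness of the Euclidean ball in the sup norm: for s <= 1 a displacement of size s changes each
    square y^2 by at most s (2 |y| + 1). *)
Lemma Vodd_ball (u : 'rV[R]_N.+1) (r : R) : 0 < r -> enorm (Vodd_of u) < r ->
  exists2 s : R, 0 < s & forall w : 'rV[R]_N.+1, `|w - u| <= s -> enorm (Vodd_of w) < r.
Proof.
move=> r0; rewrite enorm_lt // => hu.
pose C := \sum_i (2 * `|Vodd_of u 0 i| + 1).
have C0 : 0 < C.
  rewrite /C (bigD1 0) //=; apply: ltr_pwDl; first by rewrite ltr_wpDl ?mulr_ge0.
  by apply: sumr_ge0 => i _; rewrite addr_ge0 ?mulr_ge0.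
pose s := Num.min 1 ((r ^+ 2 - sqn (Vodd_of u)) / (2 * C)).
have s0 : 0 < s by rewrite lt_min ltr01 divr_gt0 ?subr_gt0 ?mulr_gt0.
have s1 : s <= 1 by rewrite ge_min lexx.
have sC : s * (2 * C) <= r ^+ 2 - sqn (Vodd_of u).
  by rewrite -ler_pdivlMr ?mulr_gt0 // ge_min lexx orbT.
exists s => // w hw; rewrite enorm_lt //.
suff : sqn (Vodd_of w) <= sqn (Vodd_of u) + s * C.
  have sC0 : 0 < s * C by rewrite mulr_gt0.
  by move: sC sC0; lra.
rewrite /sqn /C mulr_sumr -big_split /=; apply: ler_sum => i _.
have : `|Vodd_of w 0 i - Vodd_of u 0 i| <= s.
  have -> : Vodd_of w 0 i - Vodd_of u 0 i = Vodd_of (w - u) 0 i by rewrite Vodd_ofB !mxE.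
  apply: Vodd_of_le => [|k]; first exact: ltW.
  exact: le_trans (coord_le_norm _ _) hw.
set y := Vodd_of u 0 i; set z := Vodd_of w 0 i => hz.
have -> : z ^+ 2 = y ^+ 2 + 2 * (y * (z - y)) + (z - y) ^+ 2 by ring.
rewrite -addrA lerD2l [leRHS]mulrDr mulr1; apply: lerD.
  rewrite [leRHS]mulrCA ler_pM2l // [leRHS]mulrC.
  by apply: le_trans (ler_norm _) _; rewrite normrM ler_wpM2l.
rewrite -[_ ^+ 2]ger0_norm ?sqr_ge0 // normrX expr2 -[leRHS]mulr1.
by apply: ler_pM => //; apply: le_trans s1.
Qed.

Lemma real_analytic_at_ext n (f g : 'rV[R]_n -> R) x : f =1 g ->
  real_analytic_at f x -> real_analytic_at g x.
Proof. by move=> /funext ->. Qed.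

(** For y near F(u0) the simplified Newton map u |-> u - (F u - y) L contracts a closed ball around
    u0 into itself, and its fixed point is a preimage of y. *)
Lemma Lambda_image_open (t : 'I_N.+1 -> R) b (L : 'M[R]_N.+1) (rho r : R) :
  Gmx t b *m L = 1%:M ->
  (forall u w : 'rV[R]_N.+1,
    (forall i, `|u 0 i| <= rho) -> (forall i, `|w 0 i| <= rho) ->
    `|(Lambda t b (Vodd_of u) - Lambda t b (Vodd_of w)) *m L - (u - w)| <= 2^-1 * `|u - w|) ->
  0 < r -> r <= rho -> open (Lambda t b @` @Bodd R N r).
Proof.
move=> GL hexp r0 rr; rewrite openE => y [v0 [/Vodd_ofP [u0 <- _] nu0] <-] {y}.
have [s s0 hs] := Vodd_ball r0 nu0.
pose F (u : 'rV[R]_N.+1) : 'rV[R]_N.+1 := Lambda t b (Vodd_of u).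
have bd (u : 'rV[R]_N.+1) : `|u - u0| <= s -> forall i, `|u 0 i| <= rho.
  move=> /hs hu i; apply: le_trans (le_trans (ltW hu) rr).
  apply: le_trans (coord_le_enorm _ (even_index i)).
  by rewrite mxE /= odd_double doubleK inord_val.
pose S := \sum_j \sum_l `|L j l|.
have S0 : 0 <= S by do 2!apply: sumr_ge0 => ? _.
(* With this radius for y the first Newton step moves u0 by at most s / 2; the contraction accounts
   for the other half of s. *)
have q0 : 0 < s / (2 * (S + 1)) by rewrite divr_gt0 ?mulr_gt0 ?ltr_wpDl.
apply/nbhs_ballP; exists (s / (2 * (S + 1))) => // y; rewrite -ball_normE /= => hy.
have yL : `|(F u0 - y) *m L| <= s / 2.
  apply: norm_row_le => [|l]; first by rewrite divr_ge0 // ltW.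
  rewrite mxE; apply: le_trans (ler_norm_sum _ _ _) _.
  apply: (@le_trans _ _ (\sum_j s / (2 * (S + 1)) * `|L j l|)).
    apply: ler_sum => j _; rewrite normrM ler_wpM2r //.
    exact: le_trans (coord_le_norm _ _) (ltW hy).
  rewrite -mulr_sumr; apply: (@le_trans _ _ (s / (2 * (S + 1)) * S)).
    rewrite ler_wpM2l ?(ltW q0) //; apply: ler_sum => j _.
    by rewrite (bigD1 l) //= lerDl sumr_ge0.
  have -> : s / (2 * (S + 1)) * S = s / 2 * (S / (S + 1)).
    by field; rewrite gt_eqF // ltr_wpDl.
  by rewrite ler_piMr ?divr_ge0 ?(ltW s0) // ler_pdivrMr ?ltr_wpDl // mul1r lerDl.
pose Phi (u : 'rV[R]_N.+1) : 'rV[R]_N.+1 := u - (F u - y) *m L.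
pose U : set 'rV[R]_N.+1 := [set u | `|u - u0| <= s].
have ctr u w : U u -> U w -> `|Phi u - Phi w| <= 2^-1 * `|u - w|.
  move=> hu hw; have -> : Phi u - Phi w = - ((F u - F w) *m L - (u - w)).
    rewrite /Phi !mulmxBl; move: (F u *m L) (F w *m L) (y *m L) => a a' c.
    by apply/rowP => i; rewrite !mxE; ring.
  by rewrite normrN; exact: hexp (bd _ hu) (bd _ hw).
have Uu0 : U u0 by rewrite /U /= subrr normr0 ltW.
have Phis : {homo Phi : u / U u >-> U u}.
  move=> u hu; rewrite /U /=.
  have -> : Phi u - u0 = (Phi u - Phi u0) + (Phi u0 - u0) by rewrite addrA subrK.
  apply: le_trans (ler_normD _ _) _; rewrite [leRHS]splitr; apply: lerD.
    apply: le_trans (ctr _ _ hu Uu0) _; rewrite mulrC ler_wpM2r ?invr_ge0 //.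
  by rewrite /Phi addrAC subrr add0r normrN.
have [|||u Uu ufix] := @banach_fixed_point R ('rV[R]_N.+1 : completeNormedModType R) U (mkfun Phis).
- exists (2^-1)%:nng; split=> /=; first by rewrite invf_lt1 // ltr1n.
  by move=> [u w] [/= hu hw]; exact: ctr.
- rewrite (_ : U = closed_ball_ Num.norm u0 s); first exact: closed_closed_ball_.
  by apply/seteqP; split => u; rewrite /U /closed_ball_ /= distrC.
- by exists u0.
exists (Vodd_of u); first by split; [have [h _ _] := Vodd_of_bij R N; exact: h|exact: hs].
(* [L] is square, hence a two-sided inverse, and (F u - y) L = 0 forces F u = y. *)
have LG : L *m Gmx t b = 1%:M by exact: mulmx1C.
apply/eqP; rewrite -subr_eq0 -/(F u) -[F u - y]mulmx1 -LG mulmxA.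
suff -> : (F u - y) *m L = 0 by rewrite mul0mx.
move: ufix => /= /eqP; rewrite /Phi -subr_eq0 opprB addrCA subrr addr0 => /eqP //.
Qed.

(** The ball is star-shaped, so its image is a union of images of segments that share the point
    Lambda(0). Continuity along a segment follows from the strict derivative. *)
Lemma Lambda_image_connected (t : 'I_N.+1 -> R) b :
  exists2 rho : R, 0 < rho & forall r : R, 0 < r -> r <= rho ->
    connected (Lambda t b @` @Bodd R N r).
Proof.
have [rho rho0 h] := Lambda_strict_derivative t b (@ltr01 R).
exists rho => // r r0 rr.
have sc v (s : R) : Bodd r v -> 0 <= s <= 1 -> @Bodd R N r (s *: v).
  move=> [hv nv] /andP[s0 s1]; split; first by move=> i /hv e; rewrite mxE e mulr0.
  rewrite enorm_lt // sqnZ; rewrite enorm_lt // in nv; apply: le_lt_trans nv.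
  by rewrite ler_piMl ?sqn_ge0 // exprn_ile1.
have -> : Lambda t b @` @Bodd R N r =
    \bigcup_(v in @Bodd R N r) ((fun s : R => Lambda t b (s *: v)) @` `[0, 1]).
  apply/seteqP; split => y.
    by move=> [v hv <-]; exists v => //; exists 1; rewrite /= ?scale1r // in_itv /= lexx ler01.
  move=> [v hv [s /=]]; rewrite in_itv /= => hs <-; exists (s *: v) => //; exact: sc.
apply: bigcup_connected.
  exists (Lambda t b (0 : 'rV[R]_p)) => v _; exists 0; last by rewrite scale0r.
  by rewrite /= in_itv /= lexx ler01.
move=> v hv; apply: connected_continuous_connected; first exact: segment_connected.
apply/subspace_continuousP => s; rewrite /= in_itv /= => hs.
have [hvo nv] := hv; have [u uv ub] := Vodd_ofP hvo.
have ub' i : `|u 0 i| <= rho.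
  by apply: ub => k; apply: le_trans (coord_le_enorm _ _) (le_trans (ltW nv) rr).
have sE (z : R) : z *: v = Vodd_of (z *: u).
  by rewrite -uv; apply/rowP => i; rewrite !mxE; case: ifP; rewrite ?mulr0 // mxE.
have sb (z : R) : 0 <= z <= 1 -> forall i, `|(z *: u) 0 i| <= rho.
  move=> /andP[z0 z1] i; rewrite mxE normrM ger0_norm //.
  by apply: le_trans (ub' i); rewrite ler_piMl.
(* A Lipschitz constant along the segment, since the entries of [M] are at most 2; the summand 1
   keeps it positive when u = 0. *)
pose C := N.+1%:R * `|u| * 2 + 1.
have C0 : 0 < C by rewrite ltr_wpDl // !mulr_ge0.
apply/cvgrPdist_le => e e0.
have eC : 0 < e / C by rewrite divr_gt0.
near=> z.
have hz : 0 <= z <= 1.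
  have : `[0, 1]%classic z by near: z; exact: withinT.
  by rewrite /= in_itv.
have hz2 : `|s - z| <= e / C.
  near: z; apply: cvg_within.
  have /cvgrPdist_le := @cvg_id _ (nbhs s); apply => //.
rewrite /from_subspace /= !sE; have [M -> hM] := h _ _ (sb s hs) (sb z hz).
rewrite -scalerBl; apply: norm_row_le => [|j]; first exact: ltW.
rewrite mxE; apply: le_trans (ler_norm_sum _ _ _) _.
apply: (@le_trans _ _ (\sum_(k < N.+1) e / C * (`|u| * 2))).
  apply: ler_sum => k _; rewrite normrM mxE normrM -mulrA; apply: ler_pM => //.
  apply: ler_pM => //; first exact: coord_le_norm.
  have /andP[g0 g1] := grad_bound (t j) b (even_index k); have := hM k j.
  by rewrite mxE !ler_norml => /andP[? ?]; apply/andP; split; lra.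
rewrite sumr_const card_ord -[leLHS]mulr_natl.
have -> : N.+1%:R * (e / C * (`|u| * 2)) = e * ((C - 1) / C).
  by rewrite /C addrK; field; rewrite gt_eqF.
by rewrite ler_piMr ?(ltW e0) // ler_pdivrMr // mul1r gerBl.
Unshelve. all: by end_near.
Qed.

Lemma lambda00 (t b : R) : lambda0 t b (0 : 'rV[R]_p) = 0.
Proof.
by apply/eqP; rewrite -normr_le0; apply: lambda0_bound => i; rewrite mxE normr0.
Qed.

(** All small radii are covered, because (ii) needs the open image of a ball contained in B_eps. *)
Lemma Lambda_analytic_bij (t : 'I_N.+1 -> R) b (L : 'M[R]_N.+1) :
  Gmx t b *m L = 1%:M ->
  exists2 r1 : R, 0 < r1 & forall r : R, 0 < r -> r <= r1 ->
    analytic_bij_onto_domain (Bodd r) (@Lambda R N _ t b).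
Proof.
move=> GL.
have /choice [ra hra] j : exists rho : R, 0 < rho /\
    forall u : 'rV[R]_N.+1, (forall i, `|u 0 i| < rho) ->
    real_analytic_at (fun y => lambda0 (t j) b (Vodd_of y)) u.
  by have [rho ? ?] := @lambda0_analytic R N (t j) b; exists rho.
have [r2 r20 hr2] := common_radius (fun j => (hra j).1).
have [r3 r30 hr3] := Lambda_locally_inj GL.
have [r4 r40 hr4] := Lambda_expansion GL.
have [r5 r50 hr5] := Lambda_image_connected t b.
exists (Num.min (Num.min r2 r3) (Num.min r4 r5)); first by rewrite !lt_min r20 r30 r40.
move=> r r0; rewrite !le_min => /andP[/andP[h2 h3] /andP[h4 h5]].
split.
- move=> u [_ nu] j; apply: (@real_analytic_at_ext _ (fun y => lambda0 (t j) b (Vodd_of y))).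
    by move=> y; rewrite mxE.
  apply: (hra j).2 => i; apply: lt_le_trans (le_trans h2 (hr2 j)).
  apply: le_lt_trans nu; apply: le_trans (coord_le_enorm _ (even_index i)).
  by rewrite mxE /= odd_double doubleK inord_val.
- split; [by move=> v hv; exists v| |by []].
  move=> v w /set_mem [v1 v2] /set_mem [w1 w2]; apply: hr3; split => //.
  + exact: lt_le_trans v2 h3.
  + exact: lt_le_trans w2 h3.
- exact: Lambda_image_open GL hr4 r0 h4.
- exact: hr5.
- exists 0; last by apply/rowP => j; rewrite !mxE lambda00.
  split; first by move=> i _; rewrite mxE.
  by rewrite enorm_lt // (_ : sqn 0 = 0) ?exprn_gt0 //; apply/eqP; rewrite sqn_eq0.
Qed.

End LocalInversion.

(** * Invertibility of the Jacobian *)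

Section Independence.
Variable R : realType.

Lemma offdiag_sqr (t b : R) (n : nat) : odd n ->
  offdiag t b n ^+ 2 = 2 + 2 * cos (t - (3 * n%:R - 2) * b).
Proof.
move=> on; rewrite /offdiag on exprMn real_normK ?num_real //.
set y := t / 2 - _; have -> : t - (3 * n%:R - 2) * b = y *+ 2 by rewrite /y mulr2n; field.
by rewrite cos_mulr2n mulr2n; ring.
Qed.

Lemma psi_sqr (t b : R) k :
  psi t b k.*2 ^+ 2 = \prod_(m < k) offdiag t b m.*2.+1 ^+ 2.
Proof.
rewrite /psi odd_double doubleK -prodrXl; apply: eq_bigr => m _; exact: sqrrN.
Qed.

(** Column j of [Gmx] differs from the column of the psi^2 only by the factor 1 / |psi|^2, which
    does not affect the independence of the rows. *)
Lemma Gmx_left_inverse N n (t : 'I_n -> R) b :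
  (forall x : 'rV[R]_N.+1,
     (forall j, \sum_k x 0 k * psi (t j) b k.*2 ^+ 2 = 0) -> x = 0) ->
  exists L : 'M[R]_(n, N.+1), Gmx N t b *m L = 1%:M.
Proof.
move=> h; apply/row_freeP/inj_row_free => x xG; apply: h => j.
have /(congr1 (fun M : 'rV[R]_n => M 0 j)) := xG; rewrite !mxE.
set g := \sum_(i < N.*2.+1) psi (t j) b i ^+ 2.
have g0 : g != 0 by rewrite gt_eqF // (lt_le_trans ltr01) // sum_psi_ge1.
rewrite (eq_bigr (fun k => x 0 k * psi (t j) b k.*2 ^+ 2 / g)); last first.
  by move=> k _; rewrite mxE /grad -/g mulrA.
by rewrite -mulr_suml => /eqP; rewrite mulf_eq0 invr_eq0 (negbTE g0) orbF => /eqP.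
Qed.

(** * Trigonometric polynomials as polynomials in e^{it} *)

Local Open Scope complex_scope.

Definition cis (x : R) : R[i] := cos x +i* sin x.

Lemma cis_neq0 x : cis x != 0.
Proof.
rewrite eq_complex /=; apply/negP => /andP[/eqP c /eqP s].
by have := cos2Dsin2 x; rewrite c s expr0n addr0 => /esym/eqP; rewrite oner_eq0.
Qed.

(** Equal values give cos (c - a) = 1, hence sin ((c - a) / 2) = 0, impossible for a half-difference
    strictly between 0 and pi. *)
Lemma cis_inj (x y : R) : 0 <= x < 2 * pi -> 0 <= y < 2 * pi -> cis x = cis y -> x = y.
Proof.
have wl (a c : R) : 0 <= a -> a < c -> c < 2 * pi -> cis a = cis c -> False.
  move=> a0 ac c2 [ec es].
  have : cos (c - a) = 1 by rewrite cosB ec es -!expr2 cos2Dsin2.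
  have -> : c - a = ((c - a) / 2) *+ 2 by rewrite mulr2n; field.
  rewrite cos_mulr2n => e.
  have s0 : sin ((c - a) / 2) ^+ 2 = 0.
    by have := cos2Dsin2 ((c - a) / 2); move: e; rewrite mulr2n; lra.
  have : 0 < sin ((c - a) / 2) by apply: sin_gt0_pi; lra.
  by move/eqP: s0; rewrite sqrf_eq0 => /eqP ->; rewrite ltxx.
move=> /andP[x0 x2] /andP[y0 y2] e; case: (ltgtP x y) => // h; exfalso.
  exact: wl h y2 e.
exact: wl h x2 (esym e).
Qed.

(* z * (2 + 2 cos (t - be)) = tfac be evaluated at z = e^{it}. *)
Definition tfac (be : R) : {poly R[i]} :=
  (cis be)%:P + 2%:R *: 'X + cis (- be) *: 'X^2.

Lemma tfac_cis (be t : R) : (tfac be).[cis t] = cis t * (2 + 2 * cos (t - be))%:C.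
Proof.
rewrite /tfac !hornerE /cis cosN sinN cosB; apply/eqP; rewrite eq_complex /=.
have := cos2Dsin2 t; set c := cos t; set s := sin t; move=> e.
apply/andP; split; apply/eqP; apply: subr0_eq.
  by transitivity (cos be * (1 - (c ^+ 2 + s ^+ 2))); [ring|rewrite e subrr mulr0].
by transitivity (sin be * (1 - (c ^+ 2 + s ^+ 2))); [ring|rewrite e subrr mulr0].
Qed.

(** At z = e^{it} this is z^n times \sum_k c_k \prod_{m < k} (2 + 2 cos (t - be_m)); the power n - k
    gives all summands the same factor z^n. *)
Definition tpoly (be : nat -> R) n (c : nat -> R[i]) : {poly R[i]} :=
  \sum_(k < n.+1) c k *: ('X^(n - k) * \prod_(m < k) tfac (be m)).

Lemma tpolyS be n c : tpoly be n.+1 c =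
  'X * tpoly be n c + c n.+1 *: \prod_(m < n.+1) tfac (be m).
Proof.
rewrite /tpoly big_ord_recr /= subnn expr0 mul1r; congr (_ + _).
rewrite mulr_sumr; apply: eq_bigr => k _; rewrite -scalerAr mulrA -exprS.
by rewrite subSn // -ltnS.
Qed.

(** At z = 0 only the last summand survives, and there each [tfac] is nonzero, so the last
    coefficient vanishes. Division by 'X then lowers n. *)
Lemma tpoly_eq0 be n c : tpoly be n c = 0 -> forall k, (k <= n)%N -> c k = 0.
Proof.
elim: n => [|n IH].
  rewrite /tpoly big_ord_recl !big_ord0 addr0 subn0 expr0 mulr1 => /eqP.
  rewrite scaler_eq0 oner_eq0 orbF => /eqP c0 k; by rewrite leqn0 => /eqP ->.
rewrite tpolyS => e.
have cn : c n.+1 = 0.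
  have := congr1 (fun P : {poly R[i]} => P.[0]) e.
  rewrite hornerD hornerM hornerX mul0r add0r hornerZ horner_prod horner0 => /eqP.
  rewrite mulf_eq0 => /orP[/eqP //|]; rewrite prodf_seq_eq0 => /hasP [m _] /=.
  rewrite /tfac !hornerE /= => /eqP h; exfalso; move/eqP: h.
  by apply/negP; rewrite ?mulr0 ?expr0n /= ?mulr0 ?addr0 cis_neq0.
move: e; rewrite cn scale0r addr0 => /eqP; rewrite mulf_eq0 polyX_eq0 /= => /eqP e k.
by rewrite leq_eqVlt => /orP[/eqP -> //|]; rewrite ltnS; exact: IH.
Qed.

Lemma size_tfac_prod (be : nat -> R) k : (size (\prod_(m < k) tfac (be m))%R <= k.*2.+1)%N.
Proof.
elim: k => [|k IH]; first by rewrite big_ord0 size_poly1.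
rewrite big_ord_recr /=; apply: leq_trans (size_polyMleq _ _) _.
have sT : (size (tfac (be k)) <= 3)%N.
  rewrite /tfac; apply: leq_trans (size_polyD _ _) _; rewrite geq_max; apply/andP; split.
    apply: leq_trans (size_polyD _ _) _; rewrite geq_max; apply/andP; split.
      by apply: leq_trans (size_polyC_leq1 _) _.
    by apply: leq_trans (size_scale_leq _ _) _; rewrite size_polyX.
  by apply: leq_trans (size_scale_leq _ _) _; rewrite size_polyXn.
by move: IH sT; set a := size _; set d := size _; rewrite doubleS; lia.
Qed.

Lemma size_tpoly be n c : (size (tpoly be n c) <= n.*2.+1)%N.
Proof.
apply: leq_trans (size_sum _ _ _) _; apply/bigmax_leqP => -[k hk] _ /=.
apply: leq_trans (size_scale_leq _ _) _; apply: leq_trans (size_polyMleq _ _) _.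
rewrite size_polyXn; have := size_tfac_prod be k; set d := size _; lia.
Qed.

Lemma tpoly_cis be n (x : nat -> R) (t : R) :
  (tpoly be n (fun k => (x k)%:C)).[cis t] =
  cis t ^+ n * (\sum_(k < n.+1) x k * \prod_(m < k) (2 + 2 * cos (t - be m)))%:C.
Proof.
rewrite /tpoly horner_sum rmorph_sum mulr_sumr; apply: eq_bigr => -[k hk] _ /=.
rewrite hornerZ hornerM hornerXn horner_prod rmorphM rmorph_prod /=.
rewrite (eq_bigr (fun m : 'I_k => cis t * (2 + 2 * cos (t - be m))%:C)); last first.
  by move=> m _; exact: tfac_cis.
rewrite big_split /= prodr_const card_ord.
rewrite [in RHS]mulrCA; congr (_ * _); rewrite mulrA -exprD subnK //.
Qed.

(** A relation makes the 2N + 1 distinct points e^{i t_j} roots of a [tpoly] of degree at most 2N,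
    which is therefore 0. *)
Lemma psi_sqr_independent N (t : 'I_(N.*2.+1) -> R) b (x : 'rV[R]_N.+1) :
  injective t -> (forall k, 0 <= t k < 2 * pi) ->
  (forall j, \sum_k x 0 k * psi (t j) b k.*2 ^+ 2 = 0) -> x = 0.
Proof.
move=> ti tb hx; pose be m : R := (3 * m.*2.+1%:R - 2) * b.
pose c k : R := x 0 (inord k).
have Q0 : tpoly be N (fun k => (c k)%:C) = 0.
  apply/eqP/negPn/negP => Qn.
  have ar : all (root (tpoly be N (fun k => (c k)%:C)))
      [seq cis (t j) | j <- enum 'I_(N.*2.+1)].
    apply/allP => _ /mapP [j _ ->]; apply/rootP; rewrite tpoly_cis.
    rewrite (_ : \sum_(k < _) _ = 0) ?mulr0 // -[RHS](hx j); apply: eq_bigr => k _.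
    rewrite /c inord_val psi_sqr; congr (_ * _); apply: eq_bigr => m _.
    by rewrite offdiag_sqr //= odd_double.
  have un : uniq [seq cis (t j) | j <- enum 'I_(N.*2.+1)].
    rewrite map_inj_in_uniq ?enum_uniq // => i j _ _ e; apply: ti.
    exact: cis_inj e.
  have := leq_trans (max_poly_roots Qn ar un) (size_tpoly be N _).
  by rewrite size_map size_enum_ord ltnn.
apply/rowP => k; rewrite mxE.
have := tpoly_eq0 Q0 (ltn_ord k : (k <= N)%N); rewrite /c inord_val => -[] //.
Qed.

Local Close Scope complex_scope.

(** * Nonvanishing of the determinant near b = 0 *)

Lemma continuous_big_prod (I : Type) (r : seq I) (F : I -> R -> R) :
  (forall i, continuous (F i)) -> continuous (fun b => \prod_(i <- r) F i b).
Proof.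
move=> hF b; elim: r => [|i r IH].
  rewrite (_ : (fun b => _) = cst 1); first exact: cvg_cst.
  by apply/funext => c; rewrite big_nil.
rewrite (_ : (fun b => _) = (fun b => F i b * \prod_(i <- r) F i b)).
  by apply: cvgM; [exact: hF|exact: IH].
by apply/funext => c; rewrite big_cons.
Qed.

Lemma continuous_big_sum (I : Type) (r : seq I) (F : I -> R -> R) :
  (forall i, continuous (F i)) -> continuous (fun b => \sum_(i <- r) F i b).
Proof.
move=> hF b; elim: r => [|i r IH].
  rewrite (_ : (fun b => _) = cst 0); first exact: cvg_cst.
  by apply/funext => c; rewrite big_nil.
rewrite (_ : (fun b => _) = (fun b => F i b + \sum_(i <- r) F i b)).
  by apply: cvgD; [exact: hF|exact: IH].
by apply/funext => c; rewrite big_cons.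
Qed.

Definition psimx N (t : 'I_N.+1 -> R) (b : R) : 'M[R]_N.+1 :=
  \matrix_(k, j) psi (t j) b k.*2 ^+ 2.

Lemma continuous_det_psimx N (t : 'I_N.+1 -> R) : continuous (fun b => \det (psimx t b)).
Proof.
have hC k j : continuous (fun b => psimx t b k j).
  rewrite (_ : (fun b => _) = fun b => \prod_(m < k)
      (2 + 2 * cos (t j - (3 * m.*2.+1%:R - 2) * b))); last first.
    apply/funext => b; rewrite mxE psi_sqr; apply: eq_bigr => m _.
    by rewrite offdiag_sqr //= odd_double.
  apply: continuous_big_prod => m b.
  apply: cvgD; first exact: cvg_cst.
  apply: cvgM; first exact: cvg_cst.
  apply: continuous_comp; last exact: continuous_cos.
  apply: cvgB; first exact: cvg_cst.
  by apply: cvgM; [exact: cvg_cst|exact: cvg_id].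
apply: continuous_big_sum => s b; apply: cvgM; first exact: cvg_cst.
by move: b; apply: continuous_big_prod => k; exact: hC.
Qed.

(** For b = 0 all factors of the product psi^2 coincide, which gives powers of 2 + 2 cos t_j; these
    nodes are distinct because cos is injective on [0, pi]. *)
Lemma det_psimx0 N (t : 'I_N.+1 -> R) :
  0 <= t ord0 -> (forall i j : 'I_N.+1, (i < j)%N -> t i < t j) -> t ord_max <= pi ->
  \det (psimx t 0) != 0.
Proof.
move=> t0 tinc tpi.
have tb i : t i \in `[0, pi].
  rewrite in_itv /=; apply/andP; split.
    have [->//|i0] := eqVneq i ord0; apply: le_trans t0 (ltW (tinc _ _ _)).
    by rewrite lt0n.
  have [->//|im] := eqVneq i ord_max; apply: le_trans (ltW (tinc _ _ _)) tpi.
  by have := ltn_ord i; move: im; rewrite -(inj_eq val_inj) /=; lia.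
have -> : psimx t 0 = Vandermonde N.+1 (\row_j (2 + 2 * cos (t j))).
  apply/matrixP => k j; rewrite !mxE psi_sqr.
  rewrite (eq_bigr (fun=> 2 + 2 * cos (t j))); first by rewrite prodr_const card_ord.
  by move=> m _; rewrite offdiag_sqr /= ?odd_double // mulr0 subr0.
rewrite det_Vandermonde; apply/prodf_neq0 => i _; apply/prodf_neq0 => j ij.
rewrite !mxE subr_eq0; apply/eqP => e.
have : cos (t j) = cos (t i) by move: e; lra.
move/(cos_inj (tb j) (tb i)) => e'; by have := tinc i j ij; rewrite e' ltxx.
Qed.

Lemma Gmx_left_inverse_small N (t : 'I_N.+1 -> R) :
  0 <= t ord0 -> (forall i j : 'I_N.+1, (i < j)%N -> t i < t j) -> t ord_max <= pi ->
  exists2 delta : R, 0 < delta & forall b, `|b| < delta ->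
    exists L : 'M[R]_N.+1, Gmx N t b *m L = 1%:M.
Proof.
move=> t0 tinc tpi; have d0 := det_psimx0 t0 tinc tpi.
have := @continuous_det_psimx N t 0 => /cvgr_neq0 /(_ d0).
move=> /nbhs_ballP [delta /= de0 hd]; exists delta => // b hb.
have db : \det (psimx t b) != 0 by apply: hd; rewrite -ball_normE /= sub0r normrN.
apply: Gmx_left_inverse => x hx.
have xH : x *m psimx t b = 0.
  apply/rowP => j; rewrite !mxE -[RHS](hx j); apply: eq_bigr => k _; by rewrite mxE.
have Hu : psimx t b \in unitmx by rewrite unitmxE unitfE.
by rewrite -[x](mulmxK Hu) xH mul0mx.
Qed.

End Independence.

(** * Failure of global injectivity, and the theorem *)

Lemma Lambda_periodic (R : realType) N n (t : 'I_n -> R) b (k : int) :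
  @Lambda R N n t (b + 2 * pi * k%:~R) = @Lambda R N n t b.
Proof.
by apply/funext => v; apply/rowP => j; rewrite !mxE /lambda0 jacobi_periodic.
Qed.

(** The image of a small ball is a neighbourhood of 0, and by [lambda0_far] the image of a
    sufficiently large [far_potential] falls into it. *)
Lemma Lambda_not_inj (R : realType) N (t : 'I_N.+1 -> R) b (r1 eps : R) : (0 < N)%N ->
  0 < r1 -> (forall r : R, 0 < r -> r <= r1 ->
    analytic_bij_onto_domain (Bodd r) (@Lambda R N _ t b)) ->
  0 < eps -> exists v w : 'rV[R]_(N.*2.+1),
    [/\ Bodd eps v, Vodd w, ~ Bodd eps w & Lambda t b w = Lambda t b v].
Proof.
move=> N0 r10 hbij eps0.
pose e := Num.min eps r1.
have e0 : 0 < e by rewrite lt_min eps0.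
have er : e <= r1 by rewrite ge_min lexx orbT.
have [_ _ oI _ I0] := hbij e e0 er.
have /nbhs_ballP [d /= d0 hd] := open_nbhs_nbhs (conj oI I0).
(* k >= eps puts the potential outside B_eps, and k > 4 / d puts its image within distance d of
   0. *)
pose k := eps + 5 / d.
have k0 : 0 < k by rewrite addr_gt0 ?divr_gt0.
have [v [vo vn] vE] : (Lambda t b @` @Bodd R N e) (Lambda t b (far_potential N k)).
  apply: hd; rewrite -ball_normE /= sub0r normrN.
  apply: (@le_lt_trans _ _ (4 / k)).
    apply: norm_row_le => [|j]; first by rewrite divr_ge0 // ltW.
    by rewrite mxE; exact: lambda0_far.
  rewrite ltr_pdivrMr // /k mulrDr; have -> : d * (5 / d) = 5 by field; rewrite gt_eqF.
  have de0 : 0 < d * eps by rewrite mulr_gt0.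
  by move: de0; lra.
exists v, (far_potential N k); split=> //.
- by split=> //; apply: lt_le_trans vn _; rewrite ge_min lexx.
- exact: far_potential_Vodd.
- move=> [_]; apply/negP; rewrite -leNgt; apply: le_trans (far_potential_norm _ (ltW k0)).
  by rewrite lerDl divr_ge0 // ltW.
Qed.

Theorem theorem1p6 (R : realType) (N : nat) (hN : (1 <= N)%N) :
  (forall t : 'I_N.+1 -> R,
     0 <= t ord0 -> (forall i j : 'I_N.+1, (i < j)%N -> t i < t j) -> t ord_max <= pi ->
     exists delta : R, 0 < delta /\
       forall b : R, near_T0 delta b ->
         (* (i) *)
         (exists r : R, 0 < r /\ analytic_bij_onto_domain (Bodd r) (@Lambda R N _ t b)) /\
         (* (ii) *)
         (forall r : R, 0 < r -> analytic_bij_onto_domain (Bodd r) (@Lambda R N _ t b) ->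
            (forall eps : R, 0 < eps -> eps < r ->
               exists v w : 'rV[R]_(N.*2.+1),
                 [/\ Bodd eps v, Vodd w, ~ Bodd eps w & Lambda t b w = Lambda t b v]) /\
            ~ set_inj (@Vodd R N) (Lambda t b))) /\
  (* (iii) *)
  (forall (b : R) (t : 'I_(N.*2.+1) -> R),
     injective t -> (forall k, 0 <= t k < 2 * pi) ->
     exists r0 : R, 0 < r0 /\
       forall r : R, 0 < r -> r <= r0 ->
         forall v w : 'rV[R]_(N.*2.+1), Bodd r v -> Bodd r w ->
           Lambda t b v = Lambda t b w -> v = w).
Proof.
split; last first.
  move=> b t ti tb.
  have [L GL] := Gmx_left_inverse (fun x => @psi_sqr_independent R N t b x ti tb).
  have [rho rho0 h] := Lambda_locally_inj GL; exists rho; split=> // r r0 rr v w.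
  move=> [v1 v2] [w1 w2]; apply: h; split=> //; apply: lt_le_trans rr => //.
move=> t t0 tinc tpi.
have [delta d0 hd] := Gmx_left_inverse_small t0 tinc tpi.
exists delta; split=> // b [k hk].
(* The point of the circle is replaced by its representative near 0. *)
have -> : b = (b - 2 * pi * k%:~R) + 2 * pi * k%:~R by rewrite subrK.
rewrite Lambda_periodic; have [L GL] := hd _ hk.
have [r1 r10 hbij] := Lambda_analytic_bij GL.
split; first by exists r1; split=> //; exact: hbij.
move=> r r0 _; have ni := @Lambda_not_inj R N t _ r1 _ hN r10 hbij.
split=> [eps eps0 _|inj]; first exact: ni.
(* Injectivity on all of [Vodd] would identify w, outside B_r, with v inside it. *)
have [v [w [[v1 v2] w1 w2 e]]] := ni r r0; apply: w2.
suff -> : w = v by split.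
by apply: inj => //; exact/mem_set.
Qed.
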